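(* In the topological case, $\mathrm{kar}(\Phi\text{-}\mathsf{Mod})^{\mathrm{op}}$ is equivalent to the category $\Phi\text{-}\mathsf{DTop}_{\sup}$ of $\Phi$-distributive T$_0$ topological spaces and $\Phi$-cocontinuous continuous maps; in the approach case, $\mathrm{kar}(\Phi\text{-}\mathsf{Mod})^{\mathrm{op}}$ is equivalent to the category $\Phi\text{-}\mathsf{DApp}_{\sup}$ of $\Phi$-distributive T$_0$ approach spaces and $\Phi$-cocontinuous contraction maps.
   Context: Two parallel cases are treated. Topological case: $\mathsf V=\{\mathrm{false},\mathrm{true}\}=\{0,1\}$, $\otimes=\&$, $k=\mathrm{true}$, $\mathrm{false}\sqsubseteq\mathrm{true}$. Approach case: $\mathsf V=[0,\infty]$, $\otimes=+$, $k=0$, $u\sqsubseteq v$ iff $u\ge v$ numerically (so joins $\bigvee$ in $\mathsf V$ are numerical infima and meets $\bigwedge$ are numerical suprema). A $\mathsf V$-relation $r\colon X\nrightarrow Y$ is a function $X\times Y\to\mathsf V$; composition is $(s\cdot r)(x,z)=\bigvee_y r(x,y)\otimes s(y,z)$; $r^\circ(y,x)=r(x,y)$; $\mathsf V$-relations are ordered pointwise by $\sqsubseteq$; a function is viewed as the $\mathsf V$-relation given by its graph (true $\mapsto k$, false $\mapsto$ bottom of $\mathsf V$). $UX$ is the set of ultrafilters on $X$, $Uf$ the image-ultrafilter map, $e_X(x)$ the principal ultrafilter at $x$, $m_X\colon UUX\to UX$, $m_X(\mathfrak X)=\{A\subseteq X\mid A^\#\in\mathfrak X\}$ with $A^\#=\{\mathfrak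 x\in UX\mid A\in\mathfrak x\}$. For $r\colon X\nrightarrow Y$, $Ur(\mathfrak x,\mathfrak y)=\bigwedge_{A\in\mathfrak x,B\in\mathfrak y}\bigvee_{x\in A,y\in B}r(x,y)$. A space is a pair $(X,a)$ with $a\colon UX\nrightarrow X$, $e_X^\circ\sqsubseteq a$ and $a\cdot Ua\cdot m_X^\circ\sqsubseteq a$; in the topological case these are exactly the topological spaces with their ultrafilter convergence, in the approach case these are the approach spaces. A map $f\colon(X,a)\to(Y,b)$ of spaces is a function with $a(\mathfrak x,x)\sqsubseteq b(Uf(\mathfrak x),f(x))$ (continuous, respectively contraction, map). The categories are $\mathsf{Top}$ and $\mathsf{App}$. Maps are ordered by $f\le g$ iff $k\sqsubseteq b(e_Y(f(x)),g(x))$ for all $x$; $f\cong g$ means $f\le g$ and $g\le f$; $f\dashv g$ means $1\le g\cdot f$ and $f\cdot g\le 1$. The underlying order of $X$ is $x\le y$ iff $k\sqsubseteq a(e_X(x),y)$; $X$ is T$_0$ if this order is anti-symmetric. $X\otimes Y$ is $X\times Y$ with structure $c(\mathfrak w,(x,y))=a(U\pi_1(\mathfrak w),x)\otimes b(U\pi_2(\mathfrak w),y)$. $\mathsf V$ is a space: the Sierpiński space with $\{1\}$ closed, respectively $[0,\infty]$ with $\lambda(\mathfrak u,x)=\max\{x-\xi(\mathfrak u),0\}$ (with $\infty-\infty=0$), $\xi(\mathfrak u)=\sup_{A\in\mathfrak u}\inf A$. A $\mathsf U$-relation $r\colon X\rightharpoonup Y$ is a $\mathsf V$-relation $UX\nrightarrow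 Y$; Kleisli composition is $s\circ r=s\cdot Ur\cdot m_X^\circ$. A $\mathsf U$-module $\varphi\colon(X,a)\rightharpoonup(Y,b)$ is a $\mathsf U$-relation with $\varphi\circ a=\varphi$ and $b\circ\varphi=\varphi$; spaces and $\mathsf U$-modules form an ordered category $\mathsf U\text{-}\mathsf{Mod}$ with identities $a$. Each map $f\colon X\to Y$ gives $\mathsf U$-modules $f_*\colon X\rightharpoonup Y$, $f_*(\mathfrak x,y)=b(Uf(\mathfrak x),y)$, and $f^*\colon Y\rightharpoonup X$, $f^*(\mathfrak y,x)=b(\mathfrak y,f(x))$. For $x\in X$, $x^*=a(-,x)\colon X\rightharpoonup 1$, where $1$ is the one-point space. $X^{\mathrm{op}}$ is the space on $UX$ with structure $(\mathfrak X,\mathfrak x)\mapsto(Ua\cdot m_X^\circ)(\mathfrak x,m_X(\mathfrak X))$. $PX$ is the set of $\mathsf U$-modules $\psi\colon X\rightharpoonup 1$ (equivalently, maps $X^{\mathrm{op}}\to\mathsf V$) with the structure of the exponential $\mathsf V^{X^{\mathrm{op}}}$, i.e. the unique one such that for each space $Z$ a function $h\colon Z\to PX$ is a map iff $(z,\mathfrak x)\mapsto h(z)(\mathfrak x)$ is a map $Z\otimes X^{\mathrm{op}}\to\mathsf V$ (this structure exists). Standing assumption: $\Phi\text{-}\mathsf{Mod}$ is a subcategory of $\mathsf U\text{-}\mathsf{Mod}$ (on all spaces) which contains $f^*$ for every map $f$ of spaces, and such that a $\mathsf U$-module $\varphi\colon X\rightharpoonup Y$ is in $\Phi\text{-}\mathsf{Mod}$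 iff $y^*\circ\varphi$ is in $\Phi\text{-}\mathsf{Mod}$ for all $y\in Y$. $\Phi X=\{\psi\in PX\mid\psi\in\Phi\text{-}\mathsf{Mod}\}$ is a subspace of $PX$, and $y_X^\Phi\colon X\to\Phi X$, $x\mapsto x^*$. $X$ is $\Phi$-cocomplete if $y_X^\Phi$ has a left adjoint $\mathrm{Sup}_X^\Phi\colon\Phi X\to X$ in $\mathsf{Top}$/$\mathsf{App}$; a $\Phi$-cocomplete T$_0$-space $X$ is $\Phi$-distributive if $\mathrm{Sup}_X^\Phi$ has a left adjoint in $\mathsf{Top}$/$\mathsf{App}$. A colimit of a map $d\colon B\to X$ weighted by $\psi\colon B\rightharpoonup A$ in $\Phi\text{-}\mathsf{Mod}$ is a map $g\colon A\to X$ such that $g_*$ is the largest $\mathsf U$-module $\gamma\colon A\rightharpoonup X$ with $\gamma\circ\psi\sqsubseteq d_*$. A map $f\colon X\to Y$ is $\Phi$-cocontinuous if it preserves all such colimits which exist in $X$ (for $g$ a colimit of $d$ weighted by $\psi$, $f\cdot g$ is a colimit of $f\cdot d$ weighted by $\psi$); for $X,Y$ $\Phi$-cocomplete this is equivalent to $f\cdot\mathrm{Sup}_X^\Phi\cong\mathrm{Sup}_Y^\Phi\cdot\Phi f$, where $\Phi f(\psi)=\psi\circ f^*$. For a category $\mathsf A$, $\mathrm{kar}(\mathsf A)$ is the idempotent splitting completion: objects are pairs $(X,e)$ with $e\colon X\to X$ idempotent in $\mathsf A$, and a morphism $f\colon(X,e)\to(X',e')$ is an $\mathsf A$-morphism $f\colon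 X\to X'$ with $e'\cdot f=f=f\cdot e$ (the identity on $(X,e)$ is $e$). *)

(* Defs.v *)
From HB Require Import structures.
From mathcomp Require Import all_boot all_order all_algebra.
From mathcomp Require Import all_classical all_reals ereal.

Set Implicit Arguments.
Unset Strict Implicit.
Unset Printing Implicit Defensive.

Import Order.TTheory GRing.Theory Num.Theory.
Local Open Scope classical_set_scope.

Record category := Category {
  ob :> Type;
  hom : ob -> ob -> Type;
  idc : forall X, hom X X;
  ccomp : forall X Y Z, hom Y Z -> hom X Y -> hom X Z;
  comp_idl : forall X Y (f : hom X Y), ccomp (idc Y) f = f;
  comp_idr : forall X Y (f : hom X Y), ccomp f (idc X) = f;
  comp_assoc : forall X Y Z W (h : hom Z W) (g : hom Y Z) (f : hom X Y),
    ccomp h (ccomp g f) = ccomp (ccomp h g) f }.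
Arguments idc {c} _.
Arguments ccomp {c X Y Z} _ _.
Arguments hom {c} _ _.

Definition op (C : category) : category :=
  @Category C (fun X Y => hom Y X) (fun X => idc X)
    (fun X Y Z g f => ccomp f g)
    (fun X Y f => comp_idr f) (fun X Y f => comp_idl f)
    (fun X Y Z W h g f => esym (comp_assoc f g h)).

Record functor (C D : category) := Functor {
  fob :> C -> D;
  fhom : forall X Y : C, hom X Y -> hom (fob X) (fob Y);
  fhom_id : forall X : C, fhom (idc X) = idc (fob X);
  fhom_comp : forall (X Y Z : C) (g : hom Y Z) (f : hom X Y),
    fhom (ccomp g f) = ccomp (fhom g) (fhom f) }.
Arguments fhom {C D} _ {X Y} _.

Definition functor_id (C : category) : functor C C :=
  @Functor C C id (fun X Y f => f) (fun X => erefl) (fun X Y Z g f => erefl).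

Lemma functor_comp_id (C D E : category) (G : functor D E) (F : functor C D)
  (X : C) : fhom G (fhom F (idc X)) = idc (G (F X)).
Proof. by rewrite !fhom_id. Qed.

Lemma functor_comp_comp (C D E : category) (G : functor D E) (F : functor C D)
    (X Y Z : C) (g : hom Y Z) (f : hom X Y) :
  fhom G (fhom F (ccomp g f)) =
  ccomp (fhom G (fhom F g)) (fhom G (fhom F f)).
Proof. by rewrite !fhom_comp. Qed.

Definition functor_comp (C D E : category) (G : functor D E) (F : functor C D) :
    functor C E :=
  @Functor C E (fun X => G (F X)) (fun X Y f => fhom G (fhom F f))
    (functor_comp_id G F) (functor_comp_comp G F).

Definition naturally_isomorphic (C D : category) (F G : functor C D) : Prop :=
  exists (s : forall X : C, hom (F X) (G X))
      (t : forall X : C, hom (G X) (F X)),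
    [/\ forall (X Y : C) (f : hom X Y),
          ccomp (s Y) (fhom F f) = ccomp (fhom G f) (s X),
        forall X, ccomp (t X) (s X) = idc (F X) &
        forall X, ccomp (s X) (t X) = idc (G X)].

Definition equivalent (C D : category) : Prop :=
  exists (F : functor C D) (G : functor D C),
    naturally_isomorphic (functor_comp G F) (functor_id C) /\
    naturally_isomorphic (functor_comp F G) (functor_id D).

Section Kar.
Variable C : category.

Record kar_ob := KarOb {
  kar_base :> C;
  kar_idem : hom kar_base kar_base;
  kar_idemP : ccomp kar_idem kar_idem = kar_idem }.

Definition kar_hom (X Y : kar_ob) :=
  {f : hom (kar_base X) (kar_base Y) |
    ccomp (kar_idem Y) f = f /\ ccomp f (kar_idem X) = f}.

Definition kar_id (X : kar_ob) : kar_hom X X :=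
  exist _ (kar_idem X) (conj (kar_idemP X) (kar_idemP X)).

Lemma kar_comp_subproof (X Y Z : kar_ob) (g : kar_hom Y Z) (f : kar_hom X Y) :
  ccomp (kar_idem Z) (ccomp (sval g) (sval f)) = ccomp (sval g) (sval f) /\
  ccomp (ccomp (sval g) (sval f)) (kar_idem X) = ccomp (sval g) (sval f).
Proof.
case: g f => g [g1 g2] [f [f1 f2]] /=.
by split; [rewrite comp_assoc g1|rewrite -comp_assoc f2].
Qed.

Definition kar_comp (X Y Z : kar_ob) (g : kar_hom Y Z) (f : kar_hom X Y) :
    kar_hom X Z :=
  exist _ (ccomp (sval g) (sval f)) (kar_comp_subproof g f).

Lemma kar_comp_idl X Y (f : kar_hom X Y) : kar_comp (kar_id Y) f = f.
Proof. by case: f => f fP; apply: eq_exist; case: fP. Qed.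

Lemma kar_comp_idr X Y (f : kar_hom X Y) : kar_comp f (kar_id X) = f.
Proof. by case: f => f fP; apply: eq_exist; case: fP. Qed.

Lemma kar_comp_assoc X Y Z W (h : kar_hom Z W) (g : kar_hom Y Z)
    (f : kar_hom X Y) :
  kar_comp h (kar_comp g f) = kar_comp (kar_comp h g) f.
Proof. by apply: eq_exist; exact: comp_assoc. Qed.

Definition kar : category :=
  Category kar_comp_idl kar_comp_idr kar_comp_assoc.

End Kar.

Record ultrafilter (X : Type) := Ultrafilter {
  umem :> set X -> Prop;
  umemP : UltraFilter umem }.
#[global] Existing Instance umemP.

Section UltrafilterSets.
Variables (X : Type) (x : ultrafilter X).
Implicit Types A B : set X.

Lemma umemT : x setT. Proof. exact: filterT. Qed.

Lemma umemS A B : A `<=` B -> x A -> x B. Proof. exact: filterS. Qed.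

Lemma umemI A B : x A -> x B -> x (A `&` B). Proof. exact: filterI. Qed.

Lemma umem_ex A : x A -> A !=set0. Proof. exact: filter_ex. Qed.

End UltrafilterSets.

Lemma ultrafilter_le (X : Type) (x y : ultrafilter X) :
  umem x `<=` umem y -> x = y.
Proof.
case: x y => F FU [G GU] /= FG.
have GF : G = F by apply: max_filter.
by subst G; congr Ultrafilter; exact: Prop_irrelevance.
Qed.

Lemma ultrafilter_dec (X : Type) (F : set_system X) :
  ProperFilter F -> (forall A, F A \/ F (~` A)) -> UltraFilter F.
Proof.
move=> FF Fdec; split=> // G GF FG; rewrite eqEsubset; split => // A GA.
have [//|/FG GnA] := Fdec A.
by have /filter_ex [x []] : G (A `&` ~` A) by exact: filterI.
Qed.

Lemma ultrafilter_meets (X : Type) (x : ultrafilter X) (A : set X) :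
  (forall B, x B -> A `&` B !=set0) -> x A.
Proof.
move=> xA; have [//|xnA] := in_ultra_setVsetC A (umemP x).
by have [z []] := xA _ xnA.
Qed.

Lemma ultrafilter_base (I T : Type) (D : set I) (B : I -> set T) :
  D !=set0 -> (forall i, D i -> B i !=set0) ->
  (forall i j, D i -> D j -> exists2 k, D k & B k `<=` B i `&` B j) ->
  exists x : ultrafilter T, forall i, D i -> x (B i).
Proof.
move=> [i0 Di0] Bne BI.
have FF : Filter (filter_from D B).
  by apply: filter_from_filter => //; exists i0.
have FP : ProperFilter (filter_from D B) by apply: filter_from_proper.
have [G [GU FG]] := ultraFilterLemma FP.
by exists (Ultrafilter GU) => i Di; apply: FG; exists i.
Qed.

Section UltrafilterMonad.

Definition umap_sets (X Y : Type) (f : X -> Y) (x : ultrafilter X) :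
  set_system Y := [set B | x (f @^-1` B)].

Lemma umap_subproof (X Y : Type) (f : X -> Y) (x : ultrafilter X) :
  UltraFilter (umap_sets f x).
Proof.
have FP : ProperFilter (umap_sets f x) by exact: fmap_proper_filter.
apply: ultrafilter_dec => A.
exact: (in_ultra_setVsetC (f @^-1` A) (umemP x)).
Qed.

Definition umap (X Y : Type) (f : X -> Y) (x : ultrafilter X) : ultrafilter Y :=
  Ultrafilter (umap_subproof f x).

Definition uprinc (X : Type) (x : X) : ultrafilter X :=
  Ultrafilter (principal_filter_ultra x).

Definition umult_sets (X : Type) (x : ultrafilter (ultrafilter X)) :
  set_system X := [set A | x [set y : ultrafilter X | y A]].

Lemma umult_subproof (X : Type) (x : ultrafilter (ultrafilter X)) :
  UltraFilter (umult_sets x).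
Proof.
have FP : ProperFilter (umult_sets x).
  apply: Build_ProperFilter_ex.
    move=> B xB; have [y yB] := @filter_ex _ (umem x) _ _ xB.
    exact: (@filter_ex _ (umem y) _ _ yB).
  split.
  - have -> : umult_sets x setT = x setT; last exact: filterT.
    rewrite /umult_sets /=; congr (umem x _).
    by apply/seteqP; split=> y _ //=; exact: filterT.
  - move=> A B xA xB.
    have AB : [set y : ultrafilter X | y A] `&` [set y : ultrafilter X | y B]
        `<=` [set y : ultrafilter X | y (A `&` B)].
      by move=> y /= [yA yB]; exact: filterI.
    refine (@filterS _ (umem x) _ _ _ AB _).
    exact: (@filterI _ (umem x) _ _ _ xA xB).
  - move=> A B AB xA.
    have AB' : [set y : ultrafilter X | y A] `<=` [set y : ultrafilter X | y B].
      by move=> y /=; exact: filterS.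
    exact: (filterS AB' xA).
apply: ultrafilter_dec => A; rewrite /umult_sets /=.
have [|xA] := in_ultra_setVsetC [set y : ultrafilter X | y A] (umemP x).
  by left.
right; apply: filterS xA => y /= yA.
by have [|//] := in_ultra_setVsetC A (umemP y).
Qed.

Definition umult (X : Type) (x : ultrafilter (ultrafilter X)) : ultrafilter X :=
  Ultrafilter (umult_subproof x).

Lemma umap_id (X : Type) (x : ultrafilter X) : umap id x = x.
Proof. exact: ultrafilter_le. Qed.

Lemma umap_comp (X Y Z : Type) (g : Y -> Z) (f : X -> Y) (x : ultrafilter X) :
  umap (g \o f) x = umap g (umap f x).
Proof. exact: ultrafilter_le. Qed.

Lemma umap_cst (X Y : Type) (y : Y) (x : ultrafilter X) :
  umap (fun=> y) x = uprinc y.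
Proof.
apply/esym/ultrafilter_le => A /principal_filterP Ay.
have -> : (umap (fun=> y) x) A = x setT; last exact: filterT.
by congr (umem x _); apply/seteqP; split.
Qed.

Lemma umult_umap (X : Type) (x : ultrafilter (ultrafilter (ultrafilter X))) :
  umult (umap (@umult X) x) = umult (umult x).
Proof. exact: ultrafilter_le. Qed.

End UltrafilterMonad.

(* A quantale together with a convergence [vlim] making it a space; it is used
   only through its two instances [top_theory] and [app_theory]. The last two
   laws say that the tensor preserves nonempty meets and that V is completely
   distributive; they make the extension [Uext] below functorial. *)
Record theory := Theory {
  V :> Type;
  vle : V -> V -> Prop;
  vtens : V -> V -> V;
  vunit : V;
  vsup : set V -> V;
  vinf : set V -> V;
  vlim : ultrafilter V -> V -> V;
  vle_refl : forall u, vle u u;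
  vle_trans : forall v u w, vle u v -> vle v w -> vle u w;
  vle_anti : forall u v, vle u v -> vle v u -> u = v;
  vsup_ub : forall (S : set V) u, S u -> vle u (vsup S);
  vsup_le : forall (S : set V) u, (forall s, S s -> vle s u) -> vle (vsup S) u;
  vinf_lb : forall (S : set V) u, S u -> vle (vinf S) u;
  vinf_ge : forall (S : set V) u, (forall s, S s -> vle u s) -> vle u (vinf S);
  vtensA : forall u v w, vtens u (vtens v w) = vtens (vtens u v) w;
  vtensC : forall u v, vtens u v = vtens v u;
  vtens1 : forall u, vtens vunit u = u;
  vtens_sup : forall u (S : set V),
    vtens u (vsup S) = vsup [set vtens u s | s in S];
  vtens_inf : forall u (S : set V), S !=set0 ->
    vle (vinf [set vtens u s | s in S]) (vtens u (vinf S));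
  v_ccd : forall v, vle v (vsup [set u |
    forall S : set V, vle v (vsup S) -> exists2 s, S s & vle u s]) }.
Arguments vunit {t}.

Section TopTheory.

Definition top_le (u v : bool) : Prop := u ==> v.
Definition top_sup (S : set bool) : bool := `[< S true >].
Definition top_inf (S : set bool) : bool := `[< ~ S false >].

(* Convergence in the Sierpinski space whose closed sets are the empty set,
   {true} and the whole space. *)
Definition top_lim (u : ultrafilter bool) (x : bool) : bool :=
  `[< u [set true] -> x = true >].

Definition top_theory : theory.
Proof.
apply: (@Theory bool top_le andb true top_sup top_inf top_lim).
- by case.
- by move=> [] [] [].
- by move=> [] [].
- by move=> S [] //= Su; apply/implyP => _; apply/asboolP.
- by move=> S u Su; apply/implyP => /asboolP /Su.
- by move=> S [] Su; apply/implyP => /asboolP.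
- by move=> S u Su; apply/implyP => u1; apply/asboolP => /Su; rewrite /top_le u1.
- exact: andbA.
- exact: andbC.
- exact: andTb.
- move=> [] S /=; rewrite /top_sup; apply/idP/idP => /asboolP //.
  + by move=> St; apply/asboolP; exists true.
  + by move=> [[] // Ss _]; apply/asboolP.
  + by move=> [].
- move=> [] S S0; apply/implyP => /= /asboolP H.
    by apply/asboolP => Sf; apply: H; exists false.
  by case: H; case: S0 => s Ss; exists s.
- move=> [] //=; apply/implyP => _; apply/asboolP => S /= /implyP.
  move=> /(_ isT) /asboolP St.
  by exists true.
Defined.

End TopTheory.

Section AppTheory.
Variable R : realType.
Local Open Scope ereal_scope.

Definition nnereal := {x : \bar R | 0 <= x}.

(* The order is opposite to the numerical one, so joins are numerical infima and
   meets are numerical suprema; 0 is inserted because the numerical supremum of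
   the empty subset of [0, +oo] is 0. *)
Definition app_le (u v : nnereal) : Prop := sval v <= sval u.

Lemma nnereal_ge0 (u : nnereal) : 0 <= sval u.
Proof. by case: u. Qed.

Definition app_tens (u v : nnereal) : nnereal :=
  exist _ (sval u + sval v) (adde_ge0 (nnereal_ge0 u) (nnereal_ge0 v)).

Definition app_unit : nnereal := exist _ 0 (lexx (0 : \bar R)).

Lemma nnereal_inf_ge0 (S : set nnereal) : 0 <= ereal_inf [set sval u | u in S].
Proof. by apply: le_ereal_inf_tmp => _ [u _ <-]; exact: nnereal_ge0. Qed.

Definition app_sup (S : set nnereal) : nnereal :=
  exist _ (ereal_inf [set sval u | u in S]) (nnereal_inf_ge0 S).

Lemma nnereal_sup_ge0 (S : set nnereal) :
  0 <= ereal_sup (0 |` [set sval u | u in S]).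
Proof. by apply: ereal_sup_ubound; left. Qed.

Definition app_inf (S : set nnereal) : nnereal :=
  exist _ (ereal_sup (0 |` [set sval u | u in S])) (nnereal_sup_ge0 S).

Definition app_xi (u : ultrafilter nnereal) : \bar R :=
  ereal_sup [set ereal_inf [set sval x | x in A] | A in umem u].

Lemma app_lim_ge0 (u : ultrafilter nnereal) (x : nnereal) :
  0 <= maxe (sval x - app_xi u) 0.
Proof. by rewrite le_max lexx orbT. Qed.

(* In the library +oo - +oo = -oo, so that here +oo - +oo counts as 0. *)
Definition app_lim (u : ultrafilter nnereal) (x : nnereal) : nnereal :=
  exist _ (maxe (sval x - app_xi u) 0) (app_lim_ge0 u x).

Definition app_theory : theory.
Proof.
apply: (@Theory nnereal app_le app_tens app_unit app_sup app_inf app_lim).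
- by move=> u; exact: lexx.
- by move=> v u w uv vw; exact: le_trans vw uv.
- by move=> [u u0] [v v0] uv vu; apply: eq_exist; apply/eqP; rewrite eq_le vu uv.
- by move=> S u Su; apply: ereal_inf_lbound; exists u.
- by move=> S u Su; apply: le_ereal_inf_tmp => _ [s Ss <-]; exact: Su.
- by move=> S u Su; apply: ereal_sup_ubound; right; exists u.
- move=> S u Su; apply: ge_ereal_sup => _ [->|[s Ss <-]]; first exact: nnereal_ge0.
  exact: Su.
- by move=> u v w; apply: eq_exist; exact: addeA.
- by move=> u v; apply: eq_exist; exact: addeC.
- by move=> [u u0]; apply: eq_exist; exact: add0e.
- move=> u S; apply: eq_exist; apply/eqP; rewrite eq_le; apply/andP; split.
    apply: le_ereal_inf_tmp => _ [_ [s Ss <-] <-] /=.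
    by apply: leeD2l; apply: ereal_inf_lbound; exists s.
  case: u => [[u| |] u0] //=; last first.
    by rewrite addye ?leey// gt_eqF// (lt_le_trans _ (nnereal_inf_ge0 S)).
  rewrite leNgt; apply/negP; rewrite -lteBrDl// => /ereal_inf_lt [_ [s Ss <-]].
  rewrite lteBrDl// ltNge => /negP; apply.
  apply: ereal_inf_lbound.
  by exists (app_tens (exist _ u%:E u0) s) => //; exists s.
- move=> [[u| |] u0] S [s0 Ss0]; rewrite /app_le //=.
    rewrite -leeBrDl//; apply: ge_ereal_sup => _ [->|[s Ss <-]].
      rewrite leeBrDl// adde0.
      apply: (@le_trans _ _ (u%:E + sval s0)); first by rewrite leeDl// nnereal_ge0.
      apply: ereal_sup_ubound; right.
      by exists (app_tens (exist _ u%:E u0) s0) => //; exists s0.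
    rewrite leeBrDl//; apply: ereal_sup_ubound; right.
    by exists (app_tens (exist _ u%:E u0) s) => //; exists s.
  rewrite [leRHS]ereal_supy ?leey//; right.
  exists (app_tens (exist _ +oo u0) s0); first by exists s0.
  by rewrite /= addye// gt_eqF// (lt_le_trans _ (nnereal_ge0 s0)).
- move=> [[v| |] v0]; rewrite /app_le //= ?leey//.
  apply/lee_addgt0Pr => e e0; apply: ereal_inf_lbound.
  have ve0 : 0 <= v%:E + e%:E by rewrite adde_ge0// lee_fin ltW.
  exists (exist _ (v%:E + e%:E) ve0) => //= S Sv.
  have /ereal_inf_lt [_ [s Ss <-] sve] :
      ereal_inf [set sval u | u in S] < v%:E + e%:E.
    by apply: (le_lt_trans Sv); rewrite lteDl// lte_fin.
  by exists s => //; exact: ltW.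
Defined.

End AppTheory.

Section Relations.
Variable T : theory.

Definition vbot : T := vsup set0.

Definition vrel (X Y : Type) := X -> Y -> T.

Definition rle (X Y : Type) (r s : vrel X Y) : Prop :=
  forall x y, vle (r x y) (s x y).

Definition vcomp (X Y Z : Type) (s : vrel Y Z) (r : vrel X Y) : vrel X Z :=
  fun x z => vsup (range (fun y => vtens (r x y) (s y z))).

Definition vconverse (X Y : Type) (r : vrel X Y) : vrel Y X := fun y x => r x y.

Definition graph (X Y : Type) (f : X -> Y) : vrel X Y :=
  fun x y => if `[< f x = y >] then vunit else vbot.

Definition Uext (X Y : Type) (r : vrel X Y) :
    vrel (ultrafilter X) (ultrafilter Y) :=
  fun x y => vinf [set vsup [set r a b | a in A & b in B] |
                   A in umem x & B in umem y].

Definition urel (X Y : Type) := vrel (ultrafilter X) Y.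

Definition kleisli (X Y Z : Type) (s : urel Y Z) (r : urel X Y) : urel X Z :=
  vcomp s (vcomp (Uext r) (vconverse (graph (@umult X)))).

Lemma rle_anti (X Y : Type) (r s : vrel X Y) : rle r s -> rle s r -> r = s.
Proof.
by move=> rs sr; apply/funext => x; apply/funext => y; exact: vle_anti.
Qed.

Lemma vtens_mono (u v u' v' : T) :
  vle u u' -> vle v v' -> vle (vtens u v) (vtens u' v').
Proof.
have mono (w a b : T) : vle a b -> vle (vtens w a) (vtens w b).
  move=> ab; have <- : vsup [set a; b] = b.
    apply: vle_anti; last by apply: vsup_ub; right.
    by apply: vsup_le => _ [->|->] //; exact: vle_refl.
  rewrite vtens_sup.
  by apply: vsup_ub; exists a => //; left.
move=> uu' vv'.
apply: vle_trans (mono u _ _ vv') _.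
by rewrite ![vtens _ v']vtensC; exact: mono.
Qed.

Lemma vbot_le (u : T) : vle vbot u.
Proof. exact: vsup_le. Qed.

Lemma vtens_bot (u : T) : vtens vbot u = vbot.
Proof.
apply: vle_anti (vbot_le _); rewrite vtensC vtens_sup.
by apply: vsup_le => _ [? []].
Qed.

Lemma vtens_supr (X : Type) (f : X -> T) (u : T) :
  vtens u (vsup (range f)) = vsup (range (fun x => vtens u (f x))).
Proof.
apply: vle_anti.
  rewrite vtens_sup; apply: vsup_le => _ [_ [x _ <-] <-].
  by apply: vsup_ub; exists x.
apply: vsup_le => _ [x _ <-]; apply: vtens_mono; first exact: vle_refl.
by apply: vsup_ub; exists x.
Qed.

Lemma vtens_supl (X : Type) (f : X -> T) (u : T) :
  vtens (vsup (range f)) u = vsup (range (fun x => vtens (f x) u)).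
Proof.
rewrite vtensC vtens_supr; congr vsup; congr (image _ _); apply/funext => x.
exact: vtensC.
Qed.

Lemma vcompA (X Y Z W : Type) (t : vrel Z W) (s : vrel Y Z) (r : vrel X Y) :
  vcomp t (vcomp s r) = vcomp (vcomp t s) r.
Proof.
apply: rle_anti => x w; apply: vsup_le => _ [y _ <-].
- rewrite vtens_supl; apply: vsup_le => _ [z _ <-].
  apply: (@vle_trans _ (vtens (r x z) (vcomp t s z w))).
    rewrite -vtensA; apply: vtens_mono; first exact: vle_refl.
    by apply: vsup_ub; exists y.
  by apply: vsup_ub; exists z.
- rewrite vtens_supr; apply: vsup_le => _ [z _ <-].
  apply: (@vle_trans _ (vtens (vcomp s r x z) (t z w))).
    rewrite vtensA; apply: vtens_mono; last exact: vle_refl.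
    by apply: vsup_ub; exists y.
  by apply: vsup_ub; exists z.
Qed.

Lemma cgraph_comp (X Y Z : Type) (g : Y -> Z) (f : X -> Y) :
  vcomp (vconverse (graph f)) (vconverse (graph g)) =
  vconverse (graph (g \o f)).
Proof.
apply: rle_anti => z x.
  apply: vsup_le => _ [y _ <-]; rewrite /vconverse /graph.
  case: asboolP => [gy|_]; last by rewrite vtens_bot; exact: vbot_le.
  rewrite vtens1; case: asboolP => [fx|_]; last exact: vbot_le.
  by case: asboolP => [_|[]]; [exact: vle_refl|rewrite /= fx].
rewrite {1}/vconverse {1}/graph; case: asboolP => [gfx|_]; last exact: vbot_le.
rewrite -[vunit]vtens1; apply: vsup_ub; exists (f x) => //.
rewrite /vconverse /graph /=; congr vtens; case: asboolP => //.
Qed.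

Definition vbelow (u v : T) : Prop :=
  forall S : set T, vle v (vsup S) -> exists2 s, S s & vle u s.

Lemma vle_below (u v : T) : (forall w, vbelow w u -> vle w v) -> vle u v.
Proof. by move=> uv; apply: vle_trans (v_ccd u) _; apply: vsup_le. Qed.

Lemma vbelow_le (u v : T) : vbelow u v -> vle u v.
Proof.
by move=> /(_ [set v]) [|_ -> //]; apply: vsup_ub.
Qed.

Lemma Uext_ge (X Y : Type) (r : vrel X Y) x y u :
  (forall A B, umem x A -> umem y B ->
    exists a b, [/\ A a, B b & vle u (r a b)]) -> vle u (Uext r x y).
Proof.
move=> H; apply: vinf_ge => _ [A xA [B yB <-]].
have [a [b [Aa Bb ur]]] := H _ _ xA yB.
by apply: vle_trans ur _; apply: vsup_ub; exists a => //; exists b.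
Qed.

Lemma Uext_below (X Y : Type) (r : vrel X Y) x y u A B :
  vbelow u (Uext r x y) -> umem x A -> umem y B ->
  exists a b, [/\ A a, B b & vle u (r a b)].
Proof.
move=> H xA yB.
have [|_ [a Aa [b Bb <-]] ur] := H [set r a b | a in A & b in B].
  by apply: vinf_lb; exists A => //; exists B.
by exists a, b.
Qed.

Lemma Uext_below_l (X Y : Type) (r : vrel X Y) x y u A :
  vbelow u (Uext r x y) -> umem x A ->
  umem y [set b | exists2 a, A a & vle u (r a b)].
Proof.
move=> H xA; apply: ultrafilter_meets => B yB.
have [a [b [Aa Bb ur]]] := Uext_below H xA yB.
by exists b; split => //; exists a.
Qed.

Lemma Uext_le (X Y : Type) (r s : vrel X Y) : rle r s -> rle (Uext r) (Uext s).
Proof.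
move=> rs x y; apply: vle_below => u H; apply: Uext_ge => A B xA yB.
have [a [b [Aa Bb ur]]] := Uext_below H xA yB.
by exists a, b; split => //; exact: vle_trans ur (rs _ _).
Qed.

Lemma Uext_cgraph (X Y : Type) (f : X -> Y) :
  Uext (vconverse (graph f)) = vconverse (graph (umap f)).
Proof.
apply: rle_anti => y x.
  rewrite {2}/vconverse {2}/graph; case: asboolP => [fx|nfx].
    apply: vle_trans (vinf_lb _) _; last first.
      by apply: (@vsup_le _ [set graph f b a | a in setT & b in setT]) =>
        _ [a _ [b _ <-]]; rewrite /graph; case: asboolP => _;
        [exact: vle_refl|exact: vbot_le].
    by exists setT; [exact: umemT|exists setT => //; exact: umemT].
  have [B [fxB yB]] : exists B, umap f x B /\ ~ umem y B.
    apply: contrapT => /forallNP nB; apply: nfx; apply: ultrafilter_le => B fxB.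
    by apply: contrapT => nyB; apply: (nB B).
  have {}yB : umem y (~` B) by case: (in_ultra_setVsetC B (umemP y)).
  apply: vle_trans (vinf_lb _) _; last first.
    apply: (@vsup_le _ [set graph f b a | a in ~` B & b in f @^-1` B]) =>
      _ [a nBa [b Bb <-]].
    by rewrite /graph; case: asboolP => [fb|_]; [move: nBa; rewrite -fb|
      exact: vle_refl].
  by exists (~` B) => //; exists (f @^-1` B).
rewrite {1}/vconverse {1}/graph; case: asboolP => [<-|_]; last exact: vbot_le.
apply: Uext_ge => A B fxA xB.
have [b [Ab Bb]] : f @^-1` A `&` B !=set0.
  exact: (umem_ex (umemI (fxA : umem x (f @^-1` A)) xB)).
exists (f b), b; split=> //; rewrite /vconverse /graph.
by case: asboolP => // _; exact: vle_refl.
Qed.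

Lemma Uext_comp (X Y Z : Type) (s : vrel Y Z) (r : vrel X Y) :
  Uext (vcomp s r) = vcomp (Uext s) (Uext r).
Proof.
apply: rle_anti => x z; last first.
  apply: vsup_le => _ [y _ <-].
  apply: vle_trans (vtens_mono (v_ccd _) (v_ccd _)) _.
  rewrite vtensC vtens_sup.
  apply: vsup_le => _ [u uP <-].
  rewrite vtensC vtens_sup.
  apply: vsup_le => _ [v vP <-]; apply: Uext_ge => A C xA zC.
  have yB := Uext_below_l uP xA.
  have [b [c [[a Aa ur] Cc vs]]] := Uext_below vP yB zC.
  exists a, c; split=> //.
  by apply: vle_trans (vtens_mono ur vs) _; apply: vsup_ub; exists b.
apply: vle_below => u uP.
pose D := [set p : set X * set Z | umem x p.1 /\ umem z p.2].
pose B (p : set X * set Z) := [set w : X * Y * Z |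
  [/\ p.1 w.1.1, p.2 w.2 & vle u (vtens (r w.1.1 w.1.2) (s w.1.2 w.2))]].
have [w wB] : exists w : ultrafilter (X * Y * Z), forall p, D p -> w (B p).
  apply: ultrafilter_base.
  - by exists (setT, setT); split => /=; exact: umemT.
  - move=> [A C] [/= xA zC].
    have [|_ [[[a c] b] [Aa Cc] <-] ubc] :=
        uP [set vtens (r q.1.1 q.2) (s q.2 q.1.2) |
          q in [set q : X * Z * Y | A q.1.1 /\ C q.1.2]].
      apply: vle_trans (vinf_lb _) _; first by exists A => //; exists C.
      apply: vsup_le => _ [a Aa [c Cc <-]]; apply: vsup_le => _ [b _ <-].
      by apply: vsup_ub; exists (a, c, b).
    by exists (a, b, c).
  - move=> [A C] [A' C'] [/= xA zC] [/= xA' zC'].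
    exists (A `&` A', C `&` C'); first by split; exact: umemI.
    by move=> [[a b] c] [/= [? ?] [? ?] ?].
pose y := umap (fun w : X * Y * Z => w.1.2) w.
pose f (w : X * Y * Z) := r w.1.1 w.1.2.
pose g (w : X * Y * Z) := s w.1.2 w.2.
pose lims (h : X * Y * Z -> T) :=
  vinf [set vsup [set h p | p in W] | W in umem w].
have limsP (h : X * Y * Z -> T) :
    [set vsup [set h p | p in W] | W in umem w] !=set0.
  by exists (vsup [set h p | p in setT]); exists setT => //; exact: umemT.
have fr : vle (lims f) (Uext r x y).
  apply: vinf_ge => _ [A xA [C yC <-]].
  apply: vle_trans (vinf_lb _) _.
    exists (B (A, setT) `&` (fun w => w.1.2) @^-1` C) => //.
    by apply: umemI => //; apply: wB; split=> //=; exact: umemT.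
  apply: vsup_le => _ [[[a b] c] [[/= Aa _ _] Cb] <-].
  by apply: vsup_ub; exists a => //; exists b.
have gs : vle (lims g) (Uext s y z).
  apply: vinf_ge => _ [A yA [C zC <-]].
  apply: vle_trans (vinf_lb _) _.
    exists (B (setT, C) `&` (fun w => w.1.2) @^-1` A) => //.
    by apply: umemI => //; apply: wB; split=> //=; exact: umemT.
  apply: vsup_le => _ [[[a b] c] [[/= _ Cc _] Ab] <-].
  by apply: vsup_ub; exists b => //; exists c.
apply: (@vle_trans _ (vtens (Uext r x y) (Uext s y z))); last first.
  by apply: vsup_ub; exists y.
apply: (vle_trans _ (vtens_mono fr gs)).
apply: (vle_trans _ (vtens_inf (lims f) (limsP g))).
apply: vinf_ge => _ [_ [W wW <-] <-].
rewrite vtensC; apply: (vle_trans _ (vtens_inf _ (limsP f))).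
apply: vinf_ge => _ [_ [W' wW' <-] <-]; rewrite vtensC.
have [p [[Wp W'p] [_ _ up]]] : (W `&` W') `&` B (setT, setT) !=set0.
  apply: (@umem_ex _ w); apply: umemI; first exact: umemI.
  by apply: wB; split => /=; exact: umemT.
apply: vle_trans up _.
by apply: vtens_mono; apply: vsup_ub; exists p.
Qed.

Lemma cumult_Uext (X Y : Type) (r : vrel X Y) :
  vcomp (vconverse (graph (@umult Y))) (Uext r) =
  vcomp (Uext (Uext r)) (vconverse (graph (@umult X))).
Proof.
apply: rle_anti => x y.
  apply: vsup_le => _ [y' _ <-]; rewrite /vconverse /graph.
  case: asboolP => [<-|_]; last by rewrite vtensC vtens_bot; exact: vbot_le.
  rewrite vtensC vtens1; apply: vle_below => u uP.
  pose D := [set p : set X * set (ultrafilter Y) | umem x p.1 /\ umem y p.2].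
  pose B (p : set X * set (ultrafilter Y)) := [set x' : ultrafilter X |
    x' p.1 /\ exists2 y', p.2 y' & vle u (Uext r x' y')].
  have [x' xB] : exists x' : ultrafilter (ultrafilter X),
      forall p, D p -> x' (B p).
    apply: ultrafilter_base.
    - by exists (setT, setT); split => /=; exact: umemT.
    - move=> [A C] [/= xA yC].
      have yB : umem y [set y1 : ultrafilter Y |
          y1 [set b | exists2 a, A a & vle u (r a b)]] := Uext_below_l uP xA.
      have [y1 [y1B Cy1]] : [set y1 : ultrafilter Y |
          y1 [set b | exists2 a, A a & vle u (r a b)]] `&` C !=set0.
        exact: (@umem_ex _ y _ (umemI yB yC)).
      have [x1 x1P] : exists x1 : ultrafilter X, forall E, y1 E ->
          x1 [set a | A a /\ exists2 b, E b & vle u (r a b)].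
        apply: ultrafilter_base.
        + by exists setT; exact: umemT.
        + move=> E y1E; have [b [[a Aa ur] Eb]] := umem_ex (umemI y1B y1E).
          by exists a; split => //; exists b.
        + move=> E E' y1E y1E'; exists (E `&` E'); first exact: umemI.
          by move=> a [Aa [b [Eb E'b] ur]]; split; split => //; exists b.
      exists x1; split => /=.
        by apply: (umemS _ (x1P setT (umemT _))) => a [].
      exists y1 => //; apply: Uext_ge => A' E x1A' y1E.
      have [a [A'a [_ [b Eb ur]]]] := umem_ex (umemI x1A' (x1P _ y1E)).
      by exists a, b.
    - move=> [A C] [A' C'] [/= xA yC] [/= xA' yC'].
      exists (A `&` A', C `&` C'); first by split; exact: umemI.
      move=> x1 [/= x1A [y1 [Cy1 C'y1] ur]]; split; split => /=.
      + by apply: (umemS _ x1A) => a [].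
      + by exists y1.
      + by apply: (umemS _ x1A) => a [].
      + by exists y1.
  apply: (@vle_trans _ (vtens vunit (Uext (Uext r) x' y))); last first.
    apply: vsup_ub; exists x' => //; congr vtens.
    case: asboolP => // -[]; apply/esym/ultrafilter_le => A xA.
    have := xB (A, setT) (conj xA (umemT _)).
    by apply: umemS => x1 /= [].
  rewrite vtens1; apply: Uext_ge => A C x'A yC.
  have [x1 [Ax1 [_ [y1 Cy1 ur]]]] :=
    umem_ex (umemI x'A (xB (setT, C) (conj (umemT _) yC))).
  by exists x1, y1.
apply: vsup_le => _ [x' _ <-]; rewrite {1}/vconverse {1}/graph.
case: asboolP => [<-|_]; last by rewrite vtens_bot; exact: vbot_le.
apply: (@vle_trans _ (vtens (Uext r (umult x') (umult y)) vunit)); last first.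
  apply: vsup_ub; exists (umult y) => //; congr vtens.
  by rewrite /vconverse /graph; case: asboolP.
rewrite vtensC; apply: vtens_mono; last exact: vle_refl.
apply: vle_below => u uP; apply: vinf_ge => _ [A xA [B yB <-]].
have [x1 [y1 [x1A y1B ur]]] := Uext_below uP xA yB.
by apply: vle_trans ur (vinf_lb _); exists A => //; exists B.
Qed.

Lemma kleisliA (X Y Z W : Type) (t : urel Z W) (s : urel Y Z) (r : urel X Y) :
  kleisli t (kleisli s r) = kleisli (kleisli t s) r.
Proof.
rewrite /kleisli !Uext_comp Uext_cgraph -!vcompA; congr vcomp; congr vcomp.
rewrite cgraph_comp [in RHS]vcompA cumult_Uext -vcompA cgraph_comp.
congr (vcomp _ (vconverse (graph _))).
by apply/funext => x; exact: umult_umap.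
Qed.

End Relations.

Section Spaces.
Variable T : theory.

(* A set with a convergence relation, not yet subject to the axioms of a
   space. *)
Record prespace := Prespace {
  points :> Type;
  conv : urel T points points }.

Definition is_space (X : prespace) : Prop :=
  rle (vconverse (graph T (@uprinc X))) (@conv X) /\
  rle (kleisli (@conv X) (@conv X)) (@conv X).

Record space := Space {
  underlying :> prespace;
  spaceP : is_space underlying }.

Definition is_map (X Y : prespace) (f : X -> Y) : Prop :=
  forall (x : ultrafilter X) (a : X), vle (conv x a) (conv (umap f x) (f a)).

Definition under_le (X : prespace) (x y : X) : Prop :=
  vle vunit (conv (uprinc x) y).

Definition T0 (X : prespace) : Prop :=
  forall x y : X, under_le x y -> under_le y x -> x = y.

Definition map_le (X : Type) (Y : prespace) (f g : X -> Y) : Prop :=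
  forall x, under_le (f x) (g x).

(* f -| g *)
Definition left_adjoint (X Y : prespace) (f : X -> Y) (g : Y -> X) : Prop :=
  [/\ is_map f, is_map g, map_le id (g \o f) & map_le (f \o g) id].

Definition tensor (X Y : prespace) : prespace :=
  @Prespace (X * Y)
    (fun w p => vtens (conv (umap fst w) p.1) (conv (umap snd w) p.2)).

Definition vspace : prespace := @Prespace T (@vlim T).

Definition opspace (X : prespace) : prespace :=
  @Prespace (ultrafilter X) (fun w x =>
    vcomp (Uext (@conv X)) (vconverse (graph T (@umult X))) x (umult w)).

Definition subprespace (X : prespace) (Q : X -> Prop) : prespace :=
  @Prespace {x : X | Q x} (fun w x => conv (umap sval w) (sval x)).

Definition one_prespace : prespace := @Prespace unit (fun _ _ => vunit).

Lemma one_subproof : is_space one_prespace.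
Proof.
split=> [x [] | x []].
  rewrite /vconverse /graph; case: asboolP => _; first exact: vle_refl.
  exact: vbot_le.
apply: vsup_le => _ [y _ <-] /=; rewrite vtensC vtens1.
apply: vsup_le => _ [w _ <-].
apply: (@vle_trans _ (vtens vunit vunit)); last first.
  by rewrite vtens1; exact: vle_refl.
apply: vtens_mono.
  rewrite /vconverse /graph; case: asboolP => _; first exact: vle_refl.
  exact: vbot_le.
apply: (@vle_trans _ (vsup [set (vunit : T) |
    _ in [set: ultrafilter unit] & _ in [set: unit]])).
  by apply: vinf_lb; exists setT; [exact: (umemT w)|
    exists setT; [exact: (umemT y)|by []]].
by apply: vsup_le => _ [? _ [? _ <-]]; exact: vle_refl.
Qed.

Definition one_space : space := Space one_subproof.

Definition is_module (X Y : space) (r : urel T X Y) : Prop :=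
  kleisli r (@conv X) = r /\ kleisli (@conv Y) r = r.

Definition lower (X Y : space) (f : X -> Y) : urel T X Y :=
  fun x y => conv (umap f x) y.

Definition upper (X Y : space) (f : X -> Y) : urel T Y X :=
  fun y x => conv y (f x).

Definition star (X : space) (x : X) : urel T X one_space :=
  upper (fun _ : one_space => x).

Lemma is_map_id (X : prespace) : is_map (@id X).
Proof. by move=> x a; rewrite umap_id; exact: vle_refl. Qed.

Lemma is_map_comp (X Y Z : prespace) (g : Y -> Z) (f : X -> Y) :
  is_map g -> is_map f -> is_map (g \o f).
Proof.
by move=> gP fP x a; rewrite umap_comp; exact: vle_trans (fP _ _) (gP _ _).
Qed.

Lemma is_map_cst (X : space) (x : X) : is_map (fun _ : one_space => x).
Proof.
move=> u t; rewrite umap_cst; have [+ _] := spaceP X => /(_ (uprinc x) x).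
by rewrite /vconverse /graph; case: asboolP.
Qed.

Definition presheaf (X : space) : Type :=
  {psi : urel T X one_space | is_module psi}.

Definition exponential_structure (X : space)
    (c : urel T (presheaf X) (presheaf X)) : Prop :=
  is_space (Prespace c) /\
  forall (Z : space) (h : Z -> presheaf X),
    @is_map Z (Prespace c) h <->
    @is_map (tensor Z (opspace X)) vspace (fun p => sval (h p.1) p.2 tt).

(* The structure of the exponential of [vspace] by [opspace X]. It exists because
   [opspace X] is exponentiable, and it is unique, as one sees by taking h to be
   the identity; the second branch is a dummy. *)
Definition presheaf_conv (X : space) : urel T (presheaf X) (presheaf X) :=
  match pselect (exists c, @exponential_structure X c) with
  | left e => sval (cid e)
  | right _ => fun _ _ => vunit
  end.

Definition presheaf_space (X : space) : prespace := Prespace (@presheaf_conv X).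

Record module_class := ModuleClass {
  in_class : forall X Y : space, urel T X Y -> Prop;
  in_class_module : forall X Y r, @in_class X Y r -> is_module r;
  in_class_id : forall X : space, @in_class X X (@conv X);
  in_class_comp : forall (X Y Z : space) (s : urel T Y Z) (r : urel T X Y),
    in_class s -> in_class r -> @in_class X Z (kleisli s r);
  in_class_upper : forall (X Y : space) (f : X -> Y),
    is_map f -> in_class (upper f);
  in_class_fibre : forall (X Y : space) (r : urel T X Y), is_module r ->
    (in_class r <-> forall y : Y, @in_class X one_space (kleisli (star y) r)) }.

Variable Phi : module_class.

Definition mod_hom (X Y : space) := {r : urel T X Y | in_class Phi r}.

Definition mod_id (X : space) : mod_hom X X := exist _ _ (in_class_id Phi X).

Definition mod_comp (X Y Z : space) (s : mod_hom Y Z) (r : mod_hom X Y) :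
    mod_hom X Z :=
  exist _ _ (in_class_comp (proj2_sig s) (proj2_sig r)).

Lemma mod_comp_idl X Y (r : mod_hom X Y) : mod_comp (mod_id Y) r = r.
Proof. by case: r => r rP; apply: eq_exist; case: (in_class_module rP). Qed.

Lemma mod_comp_idr X Y (r : mod_hom X Y) : mod_comp r (mod_id X) = r.
Proof. by case: r => r rP; apply: eq_exist; case: (in_class_module rP). Qed.

Lemma mod_comp_assoc X Y Z W (t : mod_hom Z W) (s : mod_hom Y Z)
    (r : mod_hom X Y) :
  mod_comp t (mod_comp s r) = mod_comp (mod_comp t s) r.
Proof. by apply: eq_exist; exact: kleisliA. Qed.

Definition Mod : category :=
  Category mod_comp_idl mod_comp_idr mod_comp_assoc.

Definition PhiP (X : space) : prespace :=
  @subprespace (presheaf_space X) (fun psi => in_class Phi (sval psi)).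

Lemma star_in_class (X : space) (x : X) : in_class Phi (star x).
Proof. exact/in_class_upper/is_map_cst. Qed.

Definition yoneda (X : space) (x : X) : PhiP X :=
  exist _ (exist _ (star x) (in_class_module (star_in_class x)))
    (star_in_class x).

Definition cocomplete (X : space) : Prop :=
  exists Sup : PhiP X -> X, left_adjoint Sup (@yoneda X).

Definition distributive (X : space) : Prop :=
  [/\ T0 X, cocomplete X &
    forall Sup : PhiP X -> X, left_adjoint Sup (@yoneda X) ->
      exists t : X -> PhiP X, left_adjoint t Sup].

Definition is_colimit (A B X : space) (d : B -> X) (psi : urel T B A)
    (g : A -> X) : Prop :=
  [/\ is_map g, is_module (lower g), rle (kleisli (lower g) psi) (lower d) &
    forall gamma : urel T A X, is_module gamma ->
      rle (kleisli gamma psi) (lower d) -> rle gamma (lower g)].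

Definition cocontinuous (X Y : space) (f : X -> Y) : Prop :=
  forall (A B : space) (d : B -> X) (psi : urel T B A) (g : A -> X),
    is_map d -> in_class Phi psi ->
    is_colimit d psi g -> is_colimit (f \o d) psi (f \o g).

Record dist_space := DistSpace {
  dist_base :> space;
  dist_distributive : distributive dist_base }.

Definition dist_hom (X Y : dist_space) :=
  {f : X -> Y | is_map f /\ cocontinuous f}.

Lemma dist_id_subproof (X : dist_space) :
  is_map (@id X) /\ cocontinuous (@id X).
Proof. by split; [exact: is_map_id|]. Qed.

Definition dist_id (X : dist_space) : dist_hom X X :=
  exist _ id (dist_id_subproof X).

Lemma dist_comp_subproof (X Y Z : dist_space) (g : dist_hom Y Z)
    (f : dist_hom X Y) :
  is_map (sval g \o sval f) /\ cocontinuous (sval g \o sval f).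
Proof.
case: g f => g [gM gC] [f [fM fC]] /=; split; first exact: is_map_comp.
move=> A B d psi h dM psiP dh; apply: (gC A B (f \o d) psi (f \o h)) => //.
  exact: is_map_comp.
exact: fC.
Qed.

Definition dist_comp (X Y Z : dist_space) (g : dist_hom Y Z)
    (f : dist_hom X Y) : dist_hom X Z :=
  exist _ (sval g \o sval f) (dist_comp_subproof g f).

Lemma dist_comp_idl X Y (f : dist_hom X Y) : dist_comp (dist_id Y) f = f.
Proof. by case: f => f fP; exact: eq_exist. Qed.

Lemma dist_comp_idr X Y (f : dist_hom X Y) : dist_comp f (dist_id X) = f.
Proof. by case: f => f fP; exact: eq_exist. Qed.

Lemma dist_comp_assoc X Y Z W (h : dist_hom Z W) (g : dist_hom Y Z)
    (f : dist_hom X Y) :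
  dist_comp h (dist_comp g f) = dist_comp (dist_comp h g) f.
Proof. exact: eq_exist. Qed.

Definition DSup : category :=
  Category dist_comp_idl dist_comp_idr dist_comp_assoc.

End Spaces.

(* Main.v *)
(* For a V-relation r from UX to Y let [lift r] be Ur composed with the converse
   of the multiplication m_X; then s o r = s . lift r and [lift] is functorial,
   so everything reduces to calculations with V-relations.

   An idempotent e on X in Phi-Mod is sent to the space E of all psi in Phi X
   with psi o e = psi, which carries the universal Phi-module u from X with
   u o e = u. For s : X -> E, x |-> x^* o e, one has s^* o u = e and u o s^* is
   below the identity of E, so that Sup = (- o u) has the left adjoint
   (- o s^* ) and E is Phi-distributive. Morphisms phi act by psi |-> psi o phi.
   The values of this map at the points s x determine phi, and a cocontinuous
   map is determined by its values there, whence full faithfulness.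
   Conversely, if t -| Sup on Y, then t viewed as a module e : Y -> Y satisfies
   t (Sup psi) = psi o e, so that e is idempotent, and t identifies Y with E. *)

From mathcomp Require Import all_boot all_order all_algebra.
From mathcomp Require Import all_classical all_reals ereal.
Require Import Defs.

Set Implicit Arguments.
Unset Strict Implicit.
Unset Printing Implicit Defensive.

Import Order.TTheory.
Local Open Scope classical_set_scope.

(** * A criterion for equivalence of categories *)

(** The inverse sends [Y] to a chosen [G0 Y] and a morphism to the preimage under [F] of its
    conjugate by the chosen isomorphisms; faithfulness moves every law into [D]. *)
Lemma full_faithful_equivalent (C D : category) (F : functor C D) :
  (forall X Y (f g : hom X Y), fhom F f = fhom F g -> f = g) ->
  (forall X Y (h : hom (F X) (F Y)), exists f, fhom F f = h) ->
  (forall Y, exists X (i : hom (F X) Y) (j : hom Y (F X)),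
    ccomp i j = idc Y /\ ccomp j i = idc (F X)) ->
  equivalent C D.
Proof.
move=> Finj Fsurj Fess.
have [G0 G0P] := choice Fess.
have [i iP] : exists i : forall Y, hom (F (G0 Y)) Y, forall Y,
    exists j, ccomp (i Y) j = idc Y /\ ccomp j (i Y) = idc (F (G0 Y)).
  by exists (fun Y => sval (cid (G0P Y))) => Y; case: cid.
have {iP} [j ij ji] : exists2 j : forall Y, hom Y (F (G0 Y)),
    forall Y, ccomp (i Y) (j Y) = idc Y &
    forall Y, ccomp (j Y) (i Y) = idc (F (G0 Y)).
  exists (fun Y => sval (cid (iP Y))) => Y; case: cid => ? []; done.
pose P X Y (h : hom (F X) (F Y)) := sval (cid (Fsurj X Y h)).
have PK X Y h : fhom F (P X Y h) = h by rewrite /P; case: cid.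
pose G1 Y Z (f : hom Y Z) := P _ _ (ccomp (j Z) (ccomp f (i Y))).
have G1id Y : G1 Y Y (idc Y) = idc (G0 Y).
  by apply: Finj; rewrite PK fhom_id comp_idl ji.
have G1comp X Y Z (g : hom Y Z) (f : hom X Y) :
    G1 X Z (ccomp g f) = ccomp (G1 Y Z g) (G1 X Y f).
  apply: Finj; rewrite fhom_comp !PK -!comp_assoc; congr ccomp; congr ccomp.
  by rewrite (comp_assoc (i _)) ij comp_idl.
exists F, (Functor G1id G1comp); split.
  exists (fun X => P _ _ (i (F X))), (fun X => P _ _ (j (F X))).
  split=> [X Y f|X|X]; apply: Finj;
    rewrite !(fhom_comp, fhom_id) !PK ?ij ?ji //.
  by rewrite (comp_assoc (i _)) ij comp_idl.
exists i, j; split=> //= X Y f.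
by rewrite /= PK comp_assoc ij comp_idl.
Qed.

Lemma uprincP (X : Type) (x : X) (A : set X) : uprinc x A <-> A x.
Proof. by split=> /principal_filterP. Qed.

Lemma umap_uprinc (X Y : Type) (f : X -> Y) (x : X) :
  umap f (uprinc x) = uprinc (f x).
Proof.
by apply/esym/ultrafilter_le => A /uprincP fA; apply/(uprincP x (f @^-1` A)).
Qed.

Lemma umult_uprinc (X : Type) (x : ultrafilter X) : umult (uprinc x) = x.
Proof.
apply/esym/ultrafilter_le => A xA.
exact/(uprincP x [set y : ultrafilter X | y A]).
Qed.

(** * Lifting relations from UX to Y to relations from UX to UY *)

Section Lifting.
Variable T : theory.

Lemma vsup_range (I : Type) (f : I -> T) i : vle (f i) (vsup (range f)).
Proof. by apply: vsup_ub; exists i. Qed.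

Lemma vcomp_ge (X Y Z : Type) (s : vrel T Y Z) (r : vrel T X Y) x y z :
  vle (vtens (r x y) (s y z)) (vcomp s r x z).
Proof. exact: (vsup_range (fun y => vtens (r x y) (s y z))). Qed.

Lemma vcomp_le (X Y Z : Type) (s : vrel T Y Z) (r : vrel T X Y) x z v :
  (forall y, vle (vtens (r x y) (s y z)) v) <-> vle (vcomp s r x z) v.
Proof.
split=> [H|H y]; last exact: vle_trans (vcomp_ge _ _ _ _ _) H.
by apply: vsup_le => _ [y _ <-].
Qed.

Lemma rle_refl (X Y : Type) (r : vrel T X Y) : rle r r.
Proof. by move=> x y; exact: vle_refl. Qed.

Lemma rle_trans (X Y : Type) (s r t : vrel T X Y) :
  rle r s -> rle s t -> rle r t.
Proof. by move=> rs st x y; exact: vle_trans (rs x y) (st x y). Qed.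

Lemma vcomp_mono (X Y Z : Type) (s s' : vrel T Y Z) (r r' : vrel T X Y) :
  rle s s' -> rle r r' -> rle (vcomp s r) (vcomp s' r').
Proof.
move=> ss rr x z; apply/vcomp_le => y.
exact: vle_trans (vtens_mono (rr _ _) (ss _ _)) (vcomp_ge _ _ _ _ _).
Qed.

Lemma vcomp_graph (X Y Z : Type) (r : vrel T Y Z) (f : X -> Y) :
  vcomp r (graph T f) = fun x => r (f x).
Proof.
apply: rle_anti => x z.
  apply/vcomp_le => y; rewrite /graph; case: asboolP => [<-|_].
    by rewrite vtens1; exact: vle_refl.
  by rewrite vtens_bot; exact: vbot_le.
apply: vle_trans (vcomp_ge _ _ _ (f x) _); rewrite /graph.
by case: asboolP => // _; rewrite vtens1; exact: vle_refl.
Qed.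

Lemma vcomp_cgraph (X Y Z : Type) (r : vrel T X Z) (f : Y -> Z) :
  vcomp (vconverse (graph T f)) r = fun x y => r x (f y).
Proof.
apply: rle_anti => x y.
  apply/vcomp_le => z; rewrite /vconverse /graph vtensC.
  case: asboolP => [<-|_].
    by rewrite vtens1; exact: vle_refl.
  by rewrite vtens_bot; exact: vbot_le.
apply: vle_trans (vcomp_ge _ _ _ (f y) _); rewrite /vconverse /graph vtensC.
by case: asboolP => // _; rewrite vtens1; exact: vle_refl.
Qed.

Lemma Uext_converse (X Y : Type) (r : vrel T X Y) :
  Uext (vconverse r) = vconverse (Uext r).
Proof.
have le (A B : Type) (s : vrel T A B) :
    rle (Uext (vconverse s)) (vconverse (Uext s)).
  move=> y x; apply: vle_below => u uP; apply: Uext_ge => P Q xP yQ.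
  by have [b [a [? ? ?]]] := Uext_below uP yQ xP; exists a, b.
by apply: rle_anti => //; move=> y x; exact: (le _ _ (vconverse r) x y).
Qed.

Lemma Uext_graph (X Y : Type) (f : X -> Y) :
  Uext (graph T f) = graph T (umap f).
Proof.
by have := Uext_converse (vconverse (graph T f)); rewrite Uext_cgraph.
Qed.

Definition lift (X Y : Type) (r : urel T X Y) :
    vrel T (ultrafilter X) (ultrafilter Y) :=
  vcomp (Uext r) (vconverse (graph T (@umult X))).

Lemma kleisliE (X Y Z : Type) (s : urel T Y Z) (r : urel T X Y) :
  kleisli s r = vcomp s (lift r).
Proof. by []. Qed.

Lemma lift_ge_Uext (X Y : Type) (r : urel T X Y) x y :
  vle (Uext r x y) (lift r (umult x) y).
Proof.
apply: vle_trans (vcomp_ge _ _ _ x _); rewrite /vconverse /graph.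
by case: asboolP => // _; rewrite vtens1; exact: vle_refl.
Qed.

Lemma lift_le (X Y : Type) (r : urel T X Y) x y v :
  (forall x', umult x' = x -> vle (Uext r x' y) v) -> vle (lift r x y) v.
Proof.
move=> H; apply/vcomp_le => x'; rewrite /vconverse /graph.
case: asboolP => [xx'|_]; first by rewrite vtens1; exact: H.
by rewrite vtens_bot; exact: vbot_le.
Qed.

Lemma lift_mono (X Y : Type) (r s : urel T X Y) :
  rle r s -> rle (lift r) (lift s).
Proof.
by move=> rs; apply: vcomp_mono; [exact: Uext_le|exact: rle_refl].
Qed.

(** On the right, [cumult_Uext] moves the inner converse of m past Ur; what remains are the two ways
    of multiplying twice, identified by [umult_umap]. *)
Lemma lift_kleisli (X Y Z : Type) (s : urel T Y Z) (r : urel T X Y) :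
  lift (kleisli s r) = vcomp (lift s) (lift r).
Proof.
rewrite /lift /kleisli !Uext_comp Uext_cgraph -!vcompA; congr vcomp.
rewrite cgraph_comp [in RHS]vcompA cumult_Uext -vcompA cgraph_comp.
congr (vcomp _ (vconverse (graph _ _))).
by apply/funext => x; exact: umult_umap.
Qed.

Lemma lift_uprinc (X Y : Type) (r : urel T X Y) x y :
  vle (r x y) (lift r x (uprinc y)).
Proof.
rewrite -{2}[x]umult_uprinc; apply: vle_trans (lift_ge_Uext _ _ _).
apply: Uext_ge => A B /uprincP Ax /uprincP By.
by exists x, y; split=> //; exact: vle_refl.
Qed.

Lemma lift_pre (X Y Z : Type) (r : urel T X Y) (f : Z -> Y) :
  lift (fun x z => r x (f z)) = fun x z => lift r x (umap f z).
Proof.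
rewrite -[in LHS]vcomp_cgraph /lift Uext_comp Uext_cgraph -vcompA.
exact: vcomp_cgraph.
Qed.

Lemma lift_umap (X Y Z : Type) (r : urel T Y Z) (f : X -> Y) :
  lift (fun x => r (umap f x)) = fun x => lift r (umap f x).
Proof.
rewrite -[in LHS]vcomp_graph /lift Uext_comp Uext_graph -vcompA -Uext_graph.
rewrite -Uext_graph -cumult_Uext Uext_graph vcompA.
exact: vcomp_graph.
Qed.

Lemma kleisli_mono (X Y Z : Type) (s s' : urel T Y Z) (r r' : urel T X Y) :
  rle s s' -> rle r r' -> rle (kleisli s r) (kleisli s' r').
Proof. by move=> ss /lift_mono rr; exact: vcomp_mono. Qed.

Lemma kleisli_ge (X Y Z : Type) (s : urel T Y Z) (r : urel T X Y) x y z :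
  vle (vtens (lift r x y) (s y z)) (kleisli s r x z).
Proof. exact: vcomp_ge. Qed.

Lemma kleisli_le (X Y Z : Type) (s : urel T Y Z) (r : urel T X Y) x z v :
  (forall y, vle (vtens (lift r x y) (s y z)) v) <-> vle (kleisli s r x z) v.
Proof. exact: vcomp_le. Qed.

End Lifting.

(** * Spaces, modules and adjoint maps *)

Section SpaceTheory.
Variable T : theory.
Implicit Types X Y Z : space T.

Lemma conv_uprinc X (x : X) : vle vunit (conv (uprinc x) x).
Proof.
have [+ _] := spaceP X => /(_ (uprinc x) x).
by rewrite /vconverse /graph; case: asboolP.
Qed.

Lemma conv_trans X : rle (kleisli (@conv T X) (@conv T X)) (@conv T X).
Proof. by have [] := spaceP X. Qed.

Lemma lift_conv_map_le (X : Type) Y (f g : X -> Y) (x : ultrafilter X) :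
  map_le f g -> vle vunit (lift (@conv T Y) (umap f x) (umap g x)).
Proof.
(* The witness for the join in [lift] is the image of [x] under [a |-> uprinc (f a)]: it is related
   to [umap g x] because each [uprinc (f a)] converges to [g a]. *)
move=> fg; have -> : umap f x = umult (umap (@uprinc Y \o f) x).
  apply: ultrafilter_le => A xA.
  have fA : f @^-1` A `<=` [set a | uprinc (f a) A].
    by move=> a fa; exact/(uprincP (f a) A).
  exact: (umemS fA xA).
apply: vle_trans (lift_ge_Uext _ _ _); apply: Uext_ge => A B xA xB.
have [a [Aa Ba]] := umem_ex (umemI (xA : x (_ @^-1` A)) (xB : x (g @^-1` B))).
by exists (uprinc (f a)), (g a); split=> //; exact: fg.
Qed.

Lemma map_le_refl (X : Type) Y (f : X -> Y) : map_le f f.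
Proof. by move=> x; exact: conv_uprinc. Qed.

Lemma lift_conv_refl X (x : ultrafilter X) : vle vunit (lift (@conv T X) x x).
Proof.
have := lift_conv_map_le x (map_le_refl (Y := X) id).
by rewrite umap_id.
Qed.

Lemma kleisli_conv_ger X (Y : Type) (r : urel T X Y) :
  rle r (kleisli r (@conv T X)).
Proof.
move=> x y; apply: vle_trans (kleisli_ge _ _ _ x _).
rewrite -{1}[r x y]vtens1; apply: vtens_mono; last exact: vle_refl.
exact: lift_conv_refl.
Qed.

Lemma kleisli_conv_gel (X : Type) Y (r : urel T X Y) :
  rle r (kleisli (@conv T Y) r).
Proof.
move=> x y; apply: vle_trans (kleisli_ge _ _ _ (uprinc y) _).
rewrite -{1}[r x y]vtens1 vtensC; apply: vtens_mono; last exact: conv_uprinc.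
exact: lift_uprinc.
Qed.

Lemma is_moduleI X Y (r : urel T X Y) :
  rle (kleisli r (@conv T X)) r -> rle (kleisli (@conv T Y) r) r -> is_module r.
Proof.
move=> r1 r2; split; apply: rle_anti => //.
  exact: kleisli_conv_ger.
exact: kleisli_conv_gel.
Qed.

Lemma is_module_kleisli X Y Z (s : urel T Y Z) (r : urel T X Y) :
  is_module s -> is_module r -> is_module (kleisli s r).
Proof.
by move=> [_ s2] [r1 _]; split; [rewrite -kleisliA r1|rewrite kleisliA s2].
Qed.

Lemma lift_conv_le X (x y : ultrafilter X) z :
  vle (vtens (lift (@conv T X) x y) (conv y z)) (conv x z).
Proof. exact: vle_trans (kleisli_ge _ _ _ _ _) (conv_trans _ _). Qed.

Lemma map_lift X Y (f : X -> Y) (x y : ultrafilter X) : is_map f ->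
  vle (lift (@conv T X) x y) (lift (@conv T Y) (umap f x) (umap f y)).
Proof.
move=> fM; have /(_ x y) := lift_mono (fM : rle _ (fun u a => conv _ _)).
by rewrite (lift_pre (fun u a => conv (umap f u) a)) lift_umap.
Qed.

Lemma lift_upper X Y (f : X -> Y) :
  lift (upper f) = fun y x => lift (@conv T Y) y (umap f x).
Proof. exact: lift_pre. Qed.

Lemma lift_lower X Y (f : X -> Y) :
  lift (lower f) = fun x => lift (@conv T Y) (umap f x).
Proof. exact: lift_umap. Qed.

Lemma is_module_upper X Y (f : X -> Y) : is_map f -> is_module (upper f).
Proof.
move=> fM; apply: is_moduleI => [y x|y x]; first exact: conv_trans.
apply/kleisli_le => x'; rewrite lift_upper.
apply: vle_trans (lift_conv_le _ (umap f x') _).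
by apply: vtens_mono; [exact: vle_refl|exact: fM].
Qed.

Lemma is_module_lower X Y (f : X -> Y) : is_map f -> is_module (lower f).
Proof.
move=> fM; apply: is_moduleI => x y; last first.
  by apply/kleisli_le => y'; rewrite lift_lower; exact: lift_conv_le.
apply/kleisli_le => x'; apply: vle_trans (lift_conv_le _ (umap f x') _).
by apply: vtens_mono; [exact: map_lift|exact: vle_refl].
Qed.

Lemma kleisli_upper (X : Type) Y (Z : Type) (f : Z -> Y) (r : urel T X Y) :
  kleisli (@conv T Y) r = r ->
  kleisli (fun y z => conv y (f z)) r = fun x z => r x (f z).
Proof. by move=> rY; rewrite -[in RHS]rY. Qed.

Lemma kleisli_lower X Y (Z : Type) (f : X -> Y) (r : urel T Y Z) :
  kleisli r (@conv T Y) = r ->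
  kleisli r (lower f) = fun x => r (umap f x).
Proof. by move=> rY; rewrite -[in RHS]rY !kleisliE lift_lower. Qed.

(** Together with the next lemma, this makes [lower f] left adjoint to [upper f] among modules; here
    is the counit. *)
Lemma kleisli_lower_upper X Y (f : X -> Y) :
  rle (kleisli (lower f) (upper f)) (@conv T Y).
Proof.
move=> y y'; apply/kleisli_le => x; rewrite lift_upper.
exact: lift_conv_le.
Qed.

Lemma kleisli_upper_lower X Y (f : X -> Y) :
  is_map f -> rle (@conv T X) (kleisli (upper f) (lower f)).
Proof.
by move=> fM; rewrite kleisli_lower //; exact: (is_module_upper fM).1.
Qed.

Lemma kleisli_star X Y (r : urel T X Y) (y : Y) : is_module r ->
  kleisli (star y) r = fun x _ => r x y.
Proof. by move=> [_ rY]; exact: (kleisli_upper (fun=> y)). Qed.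

Lemma conv_under_le X (x : ultrafilter X) (y z : X) :
  under_le y z -> vle (conv x y) (conv x z).
Proof.
move=> yz; apply: vle_trans (lift_conv_le _ (uprinc y) _).
rewrite -{1}[conv x y]vtens1 vtensC; apply: vtens_mono => //.
exact: lift_uprinc.
Qed.

Lemma under_le_conv X (y z : X) :
  under_le y z <-> forall x : ultrafilter X, vle (conv x y) (conv x z).
Proof.
split=> [yz x|yz]; first exact: conv_under_le.
exact: vle_trans (conv_uprinc y) (yz _).
Qed.

Lemma map_under_le X Y (f : X -> Y) (x y : X) :
  is_map f -> under_le x y -> under_le (f x) (f y).
Proof.
by move=> fM xy; apply: vle_trans xy _; rewrite -umap_uprinc; exact: fM.
Qed.

Lemma conv_map_le (X : Type) Y (f g : X -> Y) (x : ultrafilter X) (y : Y) :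
  map_le f g -> vle (conv (umap g x) y) (conv (umap f x) y).
Proof.
move=> fg; apply: vle_trans (lift_conv_le _ (umap g x) _).
rewrite -{1}[conv _ y]vtens1; apply: vtens_mono; last exact: vle_refl.
exact: lift_conv_map_le.
Qed.

(** One inequality applies [g] and then the unit in the ultrafilter argument, the other applies [f]
    and then the counit in the point. *)
Lemma left_adjoint_conv X Y (f : X -> Y) (g : Y -> X) x y :
  left_adjoint f g -> conv (umap f x) y = conv x (g y).
Proof.
move=> [fM gM gf fg]; apply: vle_anti.
  apply: vle_trans (gM _ _) _; rewrite -umap_comp -{2}[x]umap_id.
  exact: conv_map_le.
by apply: vle_trans (fM _ _) _; apply: conv_under_le; exact: fg.
Qed.

Lemma left_adjoint_under_le X Y (f : X -> Y) (g : Y -> X) (x : X) (y : Y) :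
  left_adjoint f g -> under_le (f x) y <-> under_le x (g y).
Proof.
by move=> fg; rewrite /under_le -umap_uprinc (left_adjoint_conv _ _ fg).
Qed.

Lemma left_adjoint_unique X Y (f f' : X -> Y) (g : Y -> X) :
  T0 Y -> left_adjoint f g -> left_adjoint f' g -> f = f'.
Proof.
move=> Y0 fg f'g; apply/funext => x; apply: Y0.
  by apply/(left_adjoint_under_le _ _ fg); case: f'g => _ _.
by apply/(left_adjoint_under_le _ _ f'g); case: fg => _ _.
Qed.

(* When f -| g the modules [lower f] and [upper g] agree, and [upper g] has the
   left adjoint [lower g]. *)
Lemma left_adjoint_cocontinuous (Phi : module_class T) X Y (f : X -> Y) g :
  left_adjoint f g -> cocontinuous Phi f.
Proof.
move=> fg A B d psi h dM _ [hM _ hd hmax].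
have [fM gM _ _] := fg; have fhM := is_map_comp fM hM.
have lE (Z : space T) (k : Z -> X) :
    lower (f \o k) = fun z y => lower k z (g y).
  apply/funext => z; apply/funext => y.
  by rewrite /lower umap_comp (left_adjoint_conv _ _ fg).
split=> //; first exact: is_module_lower.
  by rewrite !lE => b y; exact: hd.
move=> gamma gammaP H; rewrite lE.
have gP := is_module_lower gM.
(* Maximality of [h] concerns modules into [X], so [gamma] is first carried there by [lower g]. *)
have gammah : rle (kleisli (lower g) gamma) (lower h).
  apply: hmax; first exact: is_module_kleisli.
  rewrite -kleisliA.
  apply: rle_trans (kleisli_mono (rle_refl _) H) _; rewrite lE.
  have <- : kleisli (upper g) (lower d) = fun b y => lower d b (g y).
    by apply: kleisli_upper; exact: (is_module_lower dM).2.
  rewrite kleisliA; have [_ {2}<-] := is_module_lower dM.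
  by apply: kleisli_mono; [exact: kleisli_lower_upper|exact: rle_refl].
move=> a y; apply: vle_trans (gammah a (g y)).
apply: vle_trans (kleisli_ge _ _ _ (uprinc y) _).
rewrite -{1}[gamma a y]vtens1 vtensC; apply: vtens_mono.
  exact: lift_uprinc.
by rewrite /lower umap_uprinc; exact: conv_uprinc.
Qed.

(** By maximality the two lower modules bound each other; at principal ultrafilters they determine
    the maps up to the underlying order. *)
Lemma colimit_unique (A B : space T) X (d : B -> X) (psi : urel T B A)
    (g g' : A -> X) :
  T0 X -> is_colimit d psi g -> is_colimit d psi g' -> g = g'.
Proof.
move=> X0 [_ gP gd gmax] [_ g'P g'd g'max].
have le (h h' : A -> X) : rle (lower h') (lower h) -> map_le h h'.
  move=> hh a; rewrite /under_le -umap_uprinc; apply: vle_trans (hh _ _).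
  by rewrite /lower umap_uprinc; exact: conv_uprinc.
by apply/funext => a; apply: X0; apply: le; [exact: gmax|exact: g'max].
Qed.

(** * Internal homs and right extensions *)

Definition vhom (u v : T) : T := vsup [set w | vle (vtens w u) v].

Lemma vhomP (u v w : T) : vle w (vhom u v) <-> vle (vtens w u) v.
Proof.
split=> wuv; last exact: vsup_ub.
apply: vle_trans (vtens_mono wuv (vle_refl u)) _.
rewrite vtensC vtens_sup; apply: vsup_le => _ [s sP <-].
by rewrite vtensC.
Qed.

(* The largest c with [kleisli c u] below u; exponentials, and the spaces which
   split idempotents, carry this structure for the evaluation u. *)
Definition rext (X E : Type) (u : urel T X E) : urel T E E :=
  fun p y => vinf (range (fun x => vhom (lift u x p) (u x y))).

Lemma rextP (X E : Type) (u : urel T X E) p y w :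
  vle w (rext u p y) <-> forall x, vle (vtens (lift u x p) w) (u x y).
Proof.
split=> [H x|H].
  rewrite vtensC; apply/vhomP/(vle_trans H)/vinf_lb; by exists x.
by apply: vinf_ge => _ [x _ <-]; apply/vhomP; rewrite vtensC.
Qed.

Lemma rext_max (X E : Type) (u : urel T X E) (c : urel T E E) :
  rle c (rext u) <-> rle (kleisli c u) u.
Proof.
split=> [cu x y|cu p y].
  by apply/kleisli_le => p; exact: (rextP _ _ _ _).1 (cu p y) x.
by apply/rextP => x; exact: vle_trans (kleisli_ge _ _ _ _ _) (cu x y).
Qed.

Lemma rext_kleisli (X E : Type) (u : urel T X E) : rle (kleisli (rext u) u) u.
Proof. by apply/rext_max; exact: rle_refl. Qed.

(** Transitivity holds because two copies of [rext u] can act on [u] one after the other; the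
    hypothesis is exactly reflexivity. *)
Lemma rext_space (X E : Type) (u : urel T X E) :
  (forall x y, vle (lift u x (uprinc y)) (u x y)) ->
  is_space (Prespace (rext u)).
Proof.
move=> uP; split.
  move=> p y; rewrite /vconverse /graph; case: asboolP => [<-|_]; last first.
    exact: vbot_le.
  by apply/rextP => x; rewrite vtensC vtens1.
apply/rext_max; rewrite -kleisliA.
apply: rle_trans (kleisli_mono (rle_refl _) (@rext_kleisli _ _ u)) _.
exact: rext_kleisli.
Qed.

Lemma rext_pre (X E E' : Type) (u : urel T X E) (f : E' -> E) p y :
  rext u (umap f p) (f y) = rext (fun x z => u x (f z)) p y.
Proof. by rewrite /rext (lift_pre u f). Qed.

(** The structure pulled back along [h] is the right extension of the pulled-back relation, so
    [rext_max] applies. *)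
Lemma rext_map (X E : Type) (u : urel T X E) Z (h : Z -> E) :
  @is_map T Z (Prespace (rext u)) h <->
  rle (kleisli (@conv T Z) (fun x z => u x (h z))) (fun x z => u x (h z)).
Proof.
rewrite -rext_max; split=> H p y.
  by rewrite -rext_pre; exact: H.
by rewrite /= rext_pre; exact: H.
Qed.

End SpaceTheory.

(** * Presheaves *)

Section Presheaves.
Variable T : theory.
Implicit Types X Y Z : space T.

(** This is ξ expressed with the order of V, so that it makes sense in both cases. *)
Definition uxi (u : ultrafilter T) : T := vinf [set vsup A | A in umem u].

(** The convergence of V is the internal hom from ξ(u) to x. Nothing else about [vlim] enters the
    proof, and both instances are checked at the end. *)
Definition residual_limits : Prop :=
  forall (u : ultrafilter T) (x w : T),
    vle w (vlim u x) <-> vle (vtens w (uxi u)) x.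

Hypothesis vlimP : residual_limits.

(** With [Uext_uxi], this describes Ur(x,y) as the join of ξ of the image of w under r, over all w
    on the product with projections x and y. *)
Lemma uxi_Uext (A B : Type) (r : vrel T A B) (w : ultrafilter (B * A)) :
  vle (uxi (umap (fun p => r p.2 p.1) w)) (Uext r (umap snd w) (umap fst w)).
Proof.
apply: vinf_ge => _ [P wP [Q wQ <-]].
pose PQ := snd @^-1` P `&` fst @^-1` Q : set (B * A).
apply: (@vle_trans _ (vsup [set r p.2 p.1 | p in PQ])).
  apply: vinf_lb; exists [set r p.2 p.1 | p in PQ] => //.
  have PQr : PQ `<=` (fun p => r p.2 p.1) @^-1` [set r p.2 p.1 | p in PQ].
    by move=> p PQp; exists p.
  exact: umemS PQr (umemI (wP : w (snd @^-1` P)) (wQ : w (fst @^-1` Q))).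
apply: vsup_le => _ [p [Pp Qp] <-].
by apply: vsup_ub; exists p.2 => //; exists p.1.
Qed.

(** The sets of pairs from members of [x] and [y] on which [r] is at least [u] form a filter base,
    nonempty since [u] is totally below the value; any ultrafilter extending it will do. *)
Lemma Uext_uxi (A B : Type) (r : vrel T A B) x y u : vbelow u (Uext r x y) ->
  exists w : ultrafilter (B * A), [/\ umap fst w = y, umap snd w = x &
    vle u (uxi (umap (fun p => r p.2 p.1) w))].
Proof.
move=> uP.
pose D := [set p : set A * set B | umem x p.1 /\ umem y p.2].
pose S (p : set A * set B) :=
  [set w : B * A | [/\ p.2 w.1, p.1 w.2 & vle u (r w.2 w.1)]].
have [w wS] : exists w : ultrafilter (B * A), forall p, D p -> w (S p).
  apply: ultrafilter_base.
  - by exists (setT, setT); split=> /=; exact: umemT.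
  - move=> [P Q] [/= xP yQ]; have [a [b [Pa Qb ur]]] := Uext_below uP xP yQ.
    by exists (b, a).
  - move=> [P Q] [P' Q'] [/= xP yQ] [/= xP' yQ'].
    exists (P `&` P', Q `&` Q'); first by split; exact: umemI.
    by move=> [b a] [/= [? ?] [? ?] ?].
exists w; split.
- apply/esym/ultrafilter_le => Q yQ.
  have SQ : S (setT, Q) `<=` fst @^-1` Q by move=> [b a] [].
  by apply: umemS SQ (wS _ _); split=> //=; exact: umemT.
- apply/esym/ultrafilter_le => P xP.
  have SP : S (P, setT) `<=` snd @^-1` P by move=> [b a] [].
  by apply: umemS SP (wS _ _); split=> //=; exact: umemT.
apply: vinf_ge => _ [V wV <-].
have [|[b a] [Vab [_ _ ur]]] :=
    umem_ex (umemI (wV : w (_ @^-1` V)) (wS (setT, setT) _)).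
  by split=> /=; exact: umemT.
exact: vle_trans ur (vsup_ub Vab).
Qed.

Definition ev X : urel T X (presheaf X) := fun x psi => sval psi x tt.
Arguments ev : clear implicits.

(** This supplies the hypothesis of [rext_space] when the fibres are presheaves: [uprinc y] is the
    image of [uprinc tt], so the claim is the module law of one fibre over the one-point space. *)
Lemma lift_fibre X (Y : Type) (u : urel T X Y) :
  (forall y, @is_module T X (one_space T) (fun x _ => u x y)) ->
  forall x y, vle (lift u x (uprinc y)) (u x y).
Proof.
move=> uM x y; have [_ uyE] := uM y.
rewrite -(umap_cst y (uprinc tt)).
have <- := congr1 (fun r => r x (uprinc tt)) (lift_pre u (fun _ : unit => y)).
have <- := congr1 (fun r => r x tt) uyE.
apply: vle_trans (kleisli_ge _ _ _ (uprinc tt) _).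
by rewrite vtensC vtens1; exact: vle_refl.
Qed.

Lemma kleisli_fibre X (Y : Type) (u : urel T X Y) :
  (forall y, @is_module T X (one_space T) (fun x _ => u x y)) ->
  kleisli u (@conv T X) = u.
Proof.
move=> uM; apply/funext => x; apply/funext => y.
by have [/(congr1 (fun r => r x tt))] := uM y.
Qed.

Lemma unit_eta (A : Type) (r : A -> unit -> T) : (fun x _ => r x tt) = r.
Proof. by apply/funext => x; apply/funext => -[]. Qed.

Lemma ev_fibre X psi : @is_module T X (one_space T) (fun x _ => ev X x psi).
Proof.
case: psi => psi psiM.
by have -> : (fun x _ => ev X x (exist _ psi psiM)) = psi by exact: unit_eta.
Qed.

(* A function h : Z -> presheaf X transposes to a map on the tensor product with
   [opspace X] iff it is, as a relation from X to Z, a module. *)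
Lemma exponential_rext X : exponential_structure (rext (ev X)).
Proof.
split; first by apply: rext_space; apply: lift_fibre; exact: ev_fibre.
move=> Z h; rewrite rext_map; set r := fun x z => ev X x (h z).
have rX : kleisli r (@conv T X) = r.
  by apply: kleisli_fibre => z; exact: ev_fibre.
split=> H.
  move=> w [z x]; apply/vlimP => /=.
  apply: vle_trans (H x z); apply: vle_trans (kleisli_ge _ _ _ (umap fst w) _).
  rewrite -vtensA vtensC; apply: vtens_mono; last exact: vle_refl.
  (* Absorbing the structure of [X] into [r] lets the convergence of [opspace X] appear, with
     [umult (umap snd w)] as intermediate ultrafilter. *)
  rewrite -rX lift_kleisli.
  apply: vle_trans (vcomp_ge _ _ _ (umult (umap snd w)) _).
  apply: vtens_mono; first exact: vle_refl.
  exact: vle_trans (uxi_Uext r w) (lift_ge_Uext _ _ _).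
move=> x z; apply/kleisli_le => z'; apply/vhomP/lift_le => x' x'x.
(* The hypothesis is tested on a [w] realizing [Uext r]; as [umult x'] is [x], its second component
   converges to [x] in [opspace X] by reflexivity. *)
apply: vle_below => u /Uext_uxi [w [wz' wx' uw]]; apply/vhomP.
have /vlimP := H w (z, x); rewrite /= wz' wx' x'x -/(lift (@conv T X) x x).
apply: vle_trans; rewrite -[vtens (conv z' z) _]/(vtens _ (lift _ _ _)).
rewrite vtensC; apply: vtens_mono => //.
rewrite -{1}[conv z' z]vtens1 vtensC; apply: vtens_mono; first exact: vle_refl.
exact: lift_conv_refl.
Qed.

(** Two structures with the same universal property make the identity a map in both directions. *)
Lemma presheaf_convE X : @presheaf_conv T X = rext (ev X).
Proof.
have [ES EU] := exponential_rext X.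
rewrite /presheaf_conv; case: pselect => [e|[]]; last by exists (rext (ev X)).
case: (cid e) => c [cS cU] /=.
apply: rle_anti => p q; rewrite -{2}[p]umap_id.
  exact: (EU (Space cS) id).2 ((cU (Space cS) id).1 (@is_map_id _ _)) p q.
exact: (cU (Space ES) id).2 ((EU (Space ES) id).1 (@is_map_id _ _)) p q.
Qed.

Variable Phi : module_class T.

Definition evPhi X : urel T X (PhiP Phi X) := fun x psi => sval (sval psi) x tt.
Arguments evPhi : clear implicits.

Definition Phi_presheaf X (psi : urel T X (one_space T))
    (psiPhi : in_class Phi psi) : PhiP Phi X :=
  exist _ (exist _ psi (in_class_module psiPhi)) psiPhi.

Lemma PhiP_eq X (psi chi : PhiP Phi X) :
  (forall x, evPhi X x psi = evPhi X x chi) -> psi = chi.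
Proof.
move: psi chi => [[psi psiM] psiP] [[chi chiM] chiP] psichi.
apply: eq_exist; apply: eq_exist.
by apply/funext => x; apply/funext => -[]; exact: psichi.
Qed.

Lemma PhiP_convE X : @conv T (PhiP Phi X) = rext (evPhi X).
Proof.
apply/funext => p; apply/funext => psi.
by rewrite /= presheaf_convE rext_pre.
Qed.

Lemma PhiP_space X : is_space (PhiP Phi X).
Proof.
rewrite /is_space PhiP_convE; apply: rext_space.
by apply: lift_fibre => psi; exact: ev_fibre.
Qed.

Canonical PhiS X : space T := Space (PhiP_space X).

Lemma in_class_fibres X Y (r : urel T X Y) : is_module r ->
  in_class Phi r <->
  forall y, @in_class _ Phi X (one_space T) (fun x _ => r x y).
Proof.
move=> rM; rewrite (in_class_fibre Phi rM).
by split=> H y; [rewrite -kleisli_star|rewrite kleisli_star].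
Qed.

(** Maps into a space of presheaves are thus the modules with fibres in it; the law over [X] comes
    from [u], the law over [Y] is [rext_map]. *)
Lemma rext_map_module X (E : Type) Y (u : urel T X E) (h : Y -> E) :
  kleisli u (@conv T X) = u ->
  @is_map T Y (Prespace (rext u)) h <-> is_module (fun x y => u x (h y)).
Proof.
move=> uX; rewrite rext_map; split=> [uY|[_ ->]]; last exact: rle_refl.
apply: is_moduleI => // x y; rewrite -[leRHS in vle _ leRHS]/(u x (h y)) -{2}uX.
exact: vle_refl.
Qed.

Lemma rext_under_le (X E : Type) (u : urel T X E) p q :
  (forall x y, vle (lift u x (uprinc y)) (u x y)) ->
  @under_le T (Prespace (rext u)) p q <-> forall x, vle (u x p) (u x q).
Proof.
move=> uE; rewrite /under_le rextP; split=> H x.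
  by apply: vle_trans (lift_uprinc u x p) _; have := H x; rewrite vtensC vtens1.
by rewrite vtensC vtens1; exact: vle_trans (uE x p) (H x).
Qed.

Lemma evPhi_fibre X psi :
  @is_module T X (one_space T) (fun x _ => evPhi X x psi).
Proof. exact: ev_fibre. Qed.

Lemma kleisli_evPhi_conv X : kleisli (evPhi X) (@conv T X) = evPhi X.
Proof. by apply: kleisli_fibre; exact: evPhi_fibre. Qed.

Lemma PhiP_map X Y (h : Y -> PhiP Phi X) :
  is_map h <-> is_module (fun x y => evPhi X x (h y)).
Proof.
rewrite -(rext_map_module _ (kleisli_evPhi_conv X)) /is_map.
by rewrite PhiP_convE.
Qed.

Lemma PhiP_under_le X (psi chi : PhiP Phi X) :
  under_le psi chi <-> forall x, vle (evPhi X x psi) (evPhi X x chi).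
Proof.
rewrite -rext_under_le; last by apply: lift_fibre; exact: evPhi_fibre.
by rewrite /under_le PhiP_convE.
Qed.

Lemma PhiP_T0 X : T0 (PhiP Phi X).
Proof.
move=> psi chi /PhiP_under_le pc /PhiP_under_le cp.
by apply: PhiP_eq => x; exact: vle_anti.
Qed.

Lemma yoneda_map X : is_map (@yoneda T Phi X).
Proof. by apply/PhiP_map; exact: in_class_module (in_class_id Phi X). Qed.

(** Evaluation is the universal module: it corresponds to the identity map. *)
Lemma evPhi_module X : is_module (evPhi X : urel T X (PhiS X)).
Proof. exact: (PhiP_map (Y := PhiS X) id).1 (@is_map_id _ _). Qed.

Lemma evPhiE X psi : (fun x _ => evPhi X x psi) = sval (sval psi).
Proof. exact: unit_eta. Qed.

Lemma evPhi_class X : in_class Phi (evPhi X : urel T X (PhiS X)).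
Proof.
apply/in_class_fibres; first exact: evPhi_module.
by move=> psi; rewrite evPhiE; exact: svalP psi.
Qed.

(** * Weighted colimits *)

Section Colimits.
Variables (E : space T) (Sup : PhiP Phi E -> E).
Hypothesis SupP : left_adjoint Sup (@yoneda T Phi E).

(** This says that [Sup \o h] has the lower module required of a colimit of the identity weighted by
    the transpose of [h]. The adjunction turns that module into convergence to [yoneda], whose
    evaluation is the structure of [E]. *)
Lemma lower_sup (A : space T) (h : A -> PhiP Phi E) (gamma : urel T A E) :
  rle gamma (lower (Sup \o h)) <->
  rle (kleisli gamma (fun x a => evPhi E x (h a))) (@conv T E).
Proof.
have lE a x : lower (Sup \o h) a x = rext (evPhi E) (umap h a) (yoneda Phi x).
  rewrite /lower umap_comp (left_adjoint_conv (X := PhiS E) _ _ SupP).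
  by rewrite -PhiP_convE.
split=> H.
  move=> x y; apply/kleisli_le => a; rewrite (lift_pre (evPhi E)).
  by have := H a y; rewrite lE => /rextP; exact.
move=> a y; rewrite lE; apply/rextP => x; apply: vle_trans (H x y).
have <- := congr1 (fun r => r x a) (lift_pre (evPhi E) h).
exact: kleisli_ge.
Qed.

Definition weight (A B : space T) (d : B -> E) (psi : urel T B A) (a : A) :=
  kleisli (star a) (kleisli psi (upper d)).

Lemma weight_class (A B : space T) (d : B -> E) (psi : urel T B A) (a : A) :
  is_map d -> in_class Phi psi -> in_class Phi (weight d psi a).
Proof.
move=> dM psiP; apply: in_class_comp; first exact: star_in_class.
by apply: in_class_comp => //; exact: in_class_upper.
Qed.

Lemma sup_colimit (A B : space T) (d : B -> E) (psi : urel T B A)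
    (dM : is_map d) (psiP : in_class Phi psi) :
  is_colimit d psi
    (fun a => Sup (Phi_presheaf (weight_class a dM psiP))).
Proof.
set h := fun a => Phi_presheaf (weight_class a dM psiP).
have hE : (fun x a => evPhi E x (h a)) = kleisli psi (upper d).
  have psidM : is_module (kleisli psi (upper d)).
    apply: (@in_class_module _ Phi); apply: in_class_comp => //.
    exact: in_class_upper.
  apply/funext => x; apply/funext => a.
  by rewrite /evPhi /= /weight kleisli_star.
have [SupM _ _ _] := SupP.
have hM : is_map h.
  apply/PhiP_map; rewrite hE; apply: (@in_class_module _ Phi).
  apply: in_class_comp => //.
  exact: in_class_upper.
have gM : is_map (Sup \o h) by exact: is_map_comp.
split=> //; first exact: is_module_lower.
(* Inserting the unit of [lower d] and [upper d] after [psi] brings in the weight of [h], to which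
   [lower_sup] applies. *)
- have /lower_sup := @rle_refl T _ _ (lower (Sup \o h)).
  rewrite hE kleisliA => H.
  apply: rle_trans (@kleisli_conv_ger _ _ _ _) _.
  apply: rle_trans (kleisli_mono (rle_refl _) (kleisli_upper_lower dM)) _.
  rewrite kleisliA; apply: rle_trans (kleisli_mono H (rle_refl _)) _.
  by rewrite (is_module_lower dM).2; exact: rle_refl.
- move=> gamma _ H; apply/lower_sup; rewrite hE kleisliA.
  apply: rle_trans (kleisli_mono H (rle_refl _)) _.
  exact: kleisli_lower_upper.
Qed.

End Colimits.

Lemma kleisli_upper_comp (A B C : space T) (f : B -> C) (d : A -> B) :
  is_map f -> kleisli (upper d) (upper f) = upper (f \o d).
Proof.
by move=> fM; rewrite [LHS]kleisli_upper //; exact: (is_module_upper fM).2.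
Qed.

(** Every weighted colimit is a [Sup] by [sup_colimit], and [Sup] is itself the colimit of the
    identity weighted by evaluation. The equation for [chi] keeps class membership proofs out of the
    statement. *)
Lemma sup_cocontinuous (E F : space T) (SupE : PhiP Phi E -> E)
    (SupF : PhiP Phi F -> F) (f : E -> F) :
  T0 E -> T0 F -> is_map f ->
  left_adjoint SupE (@yoneda T Phi E) -> left_adjoint SupF (@yoneda T Phi F) ->
  cocontinuous Phi f <->
  forall (psi : PhiP Phi E) (chi : PhiP Phi F),
    sval (sval chi) = kleisli (sval (sval psi)) (upper f) ->
    f (SupE psi) = SupF chi.
Proof.
move=> E0 F0 fM SE SF; split=> [fC psi chi chiE|fSup].
  have idM : is_map (@id E) by exact: is_map_id.
  have := fC _ _ _ _ _ idM (evPhi_class E) (sup_colimit SE idM (evPhi_class E)).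
  move=> c1; have c2 := sup_colimit SF fM (evPhi_class E).
  have /(congr1 (fun g => g psi)) /= := colimit_unique F0 c1 c2.
  have -> : Phi_presheaf (weight_class psi idM (evPhi_class E)) = psi.
    apply: PhiP_eq => x; rewrite {1}/evPhi /= /weight.
    rewrite [kleisli _ (upper id)]kleisli_evPhi_conv kleisli_star //.
    exact: evPhi_module.
  move=> ->; congr SupF; apply: PhiP_eq => x; rewrite {1}/evPhi /= /weight.
  rewrite kleisliA kleisli_star ?evPhiE ?[in RHS]/evPhi ?chiE //.
  exact: evPhi_module.
move=> A B d psi g dM psiP gP.
have fdM := is_map_comp fM dM.
rewrite (colimit_unique E0 gP (sup_colimit SE dM psiP)).
have -> : f \o (fun a => SupE (Phi_presheaf (weight_class a dM psiP))) =
    fun a => SupF (Phi_presheaf (weight_class a fdM psiP)).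
  apply/funext => a; apply: fSup => /=.
  by rewrite /weight -!kleisliA kleisli_upper_comp.
exact: sup_colimit.
Qed.

(** * Splitting an idempotent of Phi-Mod *)

Section Splitting.
Variables (X : space T) (e : urel T X X).
Hypotheses (eP : in_class Phi e) (ee : kleisli e e = e).

Definition split_points : Type :=
  {psi : urel T X (one_space T) | in_class Phi psi /\ kleisli psi e = psi}.

Definition split_ev : urel T X split_points := fun x psi => sval psi x tt.

Definition split_prespace : prespace T := Prespace (rext split_ev).

Lemma split_evE psi : (fun x _ => split_ev x psi) = sval psi.
Proof. exact: unit_eta. Qed.

Lemma split_eq (psi chi : split_points) :
  (forall x, split_ev x psi = split_ev x chi) -> psi = chi.
Proof.
case: psi chi => [psi psiP] [chi chiP] psichi; apply: eq_exist.
by apply/funext => x; apply/funext => -[]; exact: psichi.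
Qed.

Lemma split_ev_fibre psi :
  @is_module T X (one_space T) (fun x _ => split_ev x psi).
Proof. by rewrite split_evE; case: (svalP psi) => /in_class_module. Qed.

Lemma split_space_subproof : is_space split_prespace.
Proof. by apply: rext_space; apply: lift_fibre; exact: split_ev_fibre. Qed.

Canonical split_space : space T := Space split_space_subproof.

Lemma split_map Y (h : Y -> split_space) :
  is_map h <-> is_module (fun x y => split_ev x (h y)).
Proof.
by apply: rext_map_module; apply: kleisli_fibre; exact: split_ev_fibre.
Qed.

Lemma split_under_le (psi chi : split_space) :
  under_le psi chi <-> forall x, vle (split_ev x psi) (split_ev x chi).
Proof. by apply: rext_under_le; apply: lift_fibre; exact: split_ev_fibre. Qed.

Lemma split_T0 : T0 split_space.
Proof.
move=> psi chi /split_under_le pc /split_under_le cp.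
by apply: split_eq => x; exact: vle_anti.
Qed.

Lemma split_ev_module : is_module (split_ev : urel T X split_space).
Proof. exact: (split_map id).1 (@is_map_id _ _). Qed.

Lemma split_ev_class : in_class Phi (split_ev : urel T X split_space).
Proof.
apply/in_class_fibres; first exact: split_ev_module.
by move=> psi; rewrite split_evE; case: (svalP psi).
Qed.

Lemma split_ev_e : kleisli split_ev e = split_ev.
Proof.
apply/funext => x; apply/funext => psi.
by have [_ /(congr1 (fun r => r x tt))] := svalP psi.
Qed.

Lemma split_star_subproof (x : X) :
  let psi := (fun y _ => e y x) : urel T X (one_space T) in
  in_class Phi psi /\ kleisli psi e = psi.
Proof.
split; first exact: (in_class_fibres (in_class_module eP)).1 eP x.
by rewrite -[in RHS]ee.
Qed.

Definition split_star (x : X) : split_space :=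
  exist _ _ (split_star_subproof x).

Lemma split_star_map : is_map split_star.
Proof. by apply/split_map; exact: in_class_module eP. Qed.

Lemma upper_split_star : kleisli (upper split_star) split_ev = e.
Proof. by rewrite [LHS]kleisli_upper //; exact: split_ev_module.2. Qed.

Lemma split_ev_upper_star :
  rle (kleisli split_ev (upper split_star)) (@conv T split_space).
Proof.
apply/rext_max; rewrite -kleisliA upper_split_star split_ev_e.
exact: rle_refl.
Qed.

Lemma split_sup_subproof (psi : PhiP Phi split_space) :
  let r := kleisli (sval (sval psi)) split_ev in
  in_class Phi r /\ kleisli r e = r.
Proof.
split; last by rewrite -kleisliA split_ev_e.
by apply: in_class_comp split_ev_class; exact: svalP psi.
Qed.

Definition split_sup (psi : PhiP Phi split_space) : split_space :=
  exist _ _ (split_sup_subproof psi).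

Lemma split_supP : left_adjoint split_sup (@yoneda T Phi split_space).
Proof.
split.
- apply/(@split_map (PhiS split_space)).
  by apply: is_module_kleisli; [exact: evPhi_module|exact: split_ev_module].
- exact: yoneda_map.
(* The unit is one term of the join defining [kleisli]; the counit below is an equality, evaluation
   at a point. *)
- move=> psi; apply/PhiP_under_le => p; apply/rextP => x.
  exact: kleisli_ge.
- move=> psi; apply/split_under_le => x.
  have <- := congr1 (fun r => r x tt) (kleisli_star psi split_ev_module).
  exact: vle_refl.
Qed.

Lemma split_lift_subproof (psi : split_space) :
  in_class Phi (kleisli (sval psi) (upper split_star)).
Proof.
apply: in_class_comp; first by case: (svalP psi).
by apply: in_class_upper; exact: split_star_map.
Qed.

Definition split_lift (psi : split_space) : PhiP Phi split_space :=
  Phi_presheaf (split_lift_subproof psi).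

(** The unit is psi = psi o e, by [upper_split_star]; the counit is [split_ev_upper_star] composed
    with psi. *)
Lemma split_liftP : left_adjoint split_lift split_sup.
Proof.
have [supM _ _ _] := split_supP.
split=> //.
- apply/PhiP_map; apply: is_module_kleisli; first exact: split_ev_module.
  by apply: is_module_upper; exact: split_star_map.
- move=> psi; apply/split_under_le => x; rewrite {2}/split_ev /=.
  rewrite -kleisliA upper_split_star; have [_ ->] := svalP psi.
  exact: vle_refl.
- move=> psi; apply/PhiP_under_le => p; rewrite /evPhi /= -kleisliA.
  have [+ _] := svalP (sval psi) => {2}<-.
  by apply: kleisli_mono; [exact: rle_refl|exact: split_ev_upper_star].
Qed.

Lemma split_distributive : distributive Phi split_space.
Proof.
split; [exact: split_T0|by exists split_sup; exact: split_supP|].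
move=> Sup SupP; exists split_lift.
(* Distributivity quantifies over all left adjoints of [yoneda]; by T0 there is only one. *)
suff -> : Sup = split_sup by exact: split_liftP.
exact: (left_adjoint_unique (X := PhiS _) split_T0 SupP split_supP).
Qed.

End Splitting.

(** * Modules between idempotents and cocontinuous maps *)

Section SplitMaps.
Variables (X X' : space T) (e : urel T X X) (e' : urel T X' X').
Hypotheses (eP : in_class Phi e) (ee : kleisli e e = e).
Hypotheses (e'P : in_class Phi e') (ee' : kleisli e' e' = e').

Section SplitHom.
Variable phi : urel T X X'.
Hypotheses (phiP : in_class Phi phi) (phie : kleisli phi e = phi).

Lemma split_hom_subproof (psi : split_space e') :
  let r := kleisli (sval psi) phi in in_class Phi r /\ kleisli r e = r.
Proof.
split; last by rewrite -kleisliA phie.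
by apply: in_class_comp phiP; case: (svalP psi).
Qed.

Definition split_hom (psi : split_space e') : split_space e :=
  exist _ _ (split_hom_subproof psi).

Lemma split_hom_map : is_map split_hom.
Proof.
apply/split_map; apply: is_module_kleisli; first exact: split_ev_module.
exact: in_class_module phiP.
Qed.

(** Commutation with [Sup] reduces to one identity: [upper split_hom] after the evaluation for [e]
    is the evaluation for [e'] after [phi]. *)
Lemma split_hom_cocontinuous : cocontinuous Phi split_hom.
Proof.
have S := split_supP e; have S' := split_supP e'.
apply/(sup_cocontinuous (split_T0 (e:=e')) (split_T0 (e:=e)) split_hom_map
  S' S).
move=> psi chi chiE; apply: split_eq => x.
rewrite /split_ev /= chiE -!kleisliA; congr (kleisli _ _ x tt).
apply/esym/(@kleisli_upper _ _ (split_space e)).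
exact: (split_ev_module e).2.
Qed.

End SplitHom.

Lemma split_hom_inj (phi phi' : urel T X X') :
  kleisli e' phi = phi -> kleisli e' phi' = phi' ->
  kleisli (@split_ev X' e') phi = kleisli (@split_ev X' e') phi' -> phi = phi'.
Proof.
move=> phiE phi'E H; rewrite -phiE -phi'E -(upper_split_star e'P ee').
by rewrite -!kleisliA H.
Qed.

Lemma split_hom_surj (f : split_space e' -> split_space e) :
  is_map f -> cocontinuous Phi f ->
  exists phi : urel T X X', [/\ in_class Phi phi, kleisli phi e = phi,
    kleisli e' phi = phi & forall psi, sval (f psi) = kleisli (sval psi) phi].
Proof.
move=> fM fC.
have S := split_supP e; have S' := split_supP e'.
have fSup := (sup_cocontinuous (@split_T0 _ _) (@split_T0 _ _) fM S' S).1 fC.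
pose s := split_star e'P ee'; have sM : is_map s by exact: split_star_map.
pose phi : urel T X X' := fun x x' => split_ev x (f (s x')).
have phiM : is_module phi.
  exact: (split_map (f \o s)).1 (is_map_comp fM sM).
have phiP : in_class Phi phi.
  apply/in_class_fibres => // x'; rewrite split_evE.
  by case: (svalP (f (s x'))).
have phie : kleisli phi e = phi.
  apply/funext => x; apply/funext => x'.
  exact: (congr1 (fun r : urel T X (split_space e) => r x _) (split_ev_e e)).
have fE psi : sval (f psi) = kleisli (sval psi) phi.
  (* Every point is a [Sup] of a presheaf pushed forward along [s], so [f] is determined by
     [f \o s], whose transpose is [phi]. *)
  have psiE : psi = split_sup (split_lift e'P ee' psi).
    apply: split_eq => x; rewrite /split_ev /= -kleisliA upper_split_star.
    by have [_ ->] := svalP psi.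
  have chiP : in_class Phi (kleisli (kleisli (sval psi) (upper s)) (upper f)).
    apply: in_class_comp; last exact: in_class_upper.
    exact: split_lift_subproof.
  rewrite {1}psiE (fSup _ (Phi_presheaf chiP)) //= -!kleisliA.
  congr kleisli; rewrite kleisliA.
  have -> : kleisli (upper s) (upper f) = upper (f \o s).
    exact: kleisli_upper_comp.
  by apply: (@kleisli_upper _ _ (split_space e)); exact: (split_ev_module e).2.
exists phi; split=> //.
(* [s x'] is the fibre of [e'] at [x'], so [fE] there reads phi = e' o phi. *)
apply/funext => x; apply/funext => x'.
by have /(congr1 (fun r => r x tt)) := fE (s x').
Qed.

End SplitMaps.

(** * A distributive space splits the idempotent of its Sup *)

Section DistributiveSplits.
Variables (Y : space T) (Sup : PhiP Phi Y -> Y) (t : Y -> PhiP Phi Y).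
Hypotheses (Y0 : T0 Y) (SupP : left_adjoint Sup (@yoneda T Phi Y)).
Hypothesis tP : left_adjoint t Sup.

Lemma sup_yoneda y : Sup (yoneda Phi y) = y.
Proof.
have [_ _ ySup Supy] := SupP; apply: Y0; first exact: Supy.
by apply/under_le_conv => x; have /PhiP_under_le := ySup (yoneda Phi y); exact.
Qed.

Lemma sup_lift y : Sup (t y) = y.
Proof.
have [SupM _ _ _] := SupP; have [_ _ Supt tSup] := tP.
apply: Y0; last exact: Supt.
rewrite -[X in under_le _ X]sup_yoneda.
(* It suffices that [t y] lies below [yoneda y], the counit of t -| Sup at [yoneda y]. *)
apply: (map_under_le (X := PhiS Y)) => //.
by rewrite -{1}[y]sup_yoneda; exact: tSup.
Qed.

Definition lift_idem : urel T Y Y := fun x y => evPhi Y x (t y).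

Lemma lift_idem_class : in_class Phi lift_idem.
Proof.
have [tM _ _ _] := tP.
apply/in_class_fibres; first exact: (PhiP_map t).1 tM.
by move=> y; rewrite evPhiE; exact: svalP (t y).
Qed.

Lemma lift_sup_class (psi : PhiP Phi Y) :
  in_class Phi (kleisli (sval (sval psi)) lift_idem).
Proof. by apply: in_class_comp lift_idem_class; exact: svalP psi. Qed.

Lemma lift_sup (psi : PhiP Phi Y) :
  t (Sup psi) = Phi_presheaf (lift_sup_class psi).
Proof.
have [SupM _ ySup _] := SupP; have [tM _ _ _] := tP.
apply: PhiP_T0.
  apply/(left_adjoint_under_le (Y := PhiS Y) _ _ tP).
  apply/(left_adjoint_under_le (X := PhiS Y) _ _ SupP).
  apply/PhiP_under_le => x; set chi := Phi_presheaf _.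
  (* After both transpositions, psi(x) has to be below the convergence of [x] to [Sup chi]. The
     middle term is mapped there by [Sup], as Sup o t = 1, and bounds psi(x) by the definition of
     [rext]. *)
  apply: (@vle_trans _ (conv (umap t x) chi)); last first.
    apply: vle_trans (SupM _ _) _; rewrite -umap_comp.
    have -> : Sup \o t = id by apply/funext => y; exact: sup_lift.
    by rewrite umap_id; exact: vle_refl.
  rewrite PhiP_convE; apply/rextP => z.
  have <- := congr1 (fun r => r z x) (lift_pre (evPhi Y) t).
  exact: kleisli_ge.
apply/PhiP_under_le => x; apply/kleisli_le => y.
rewrite (lift_pre (evPhi Y) t).
have /PhiP_under_le /(_ y) psiy := ySup psi.
(* psi(y) is at most the convergence of [y] to [Sup psi], which [t] preserves. *)
have := tM y (Sup psi); rewrite PhiP_convE => /rextP /(_ x); apply: vle_trans.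
by apply: vtens_mono; first exact: vle_refl.
Qed.

Lemma lift_idemK : kleisli lift_idem lift_idem = lift_idem.
Proof.
apply/funext => x; apply/funext => y.
have := congr1 (fun psi => evPhi Y x psi) (lift_sup (t y)).
by rewrite sup_lift => /esym.
Qed.

Lemma to_split_subproof (y : Y) :
  let r := sval (sval (t y)) in in_class Phi r /\ kleisli r lift_idem = r.
Proof.
split; first exact: svalP (t y).
have := congr1 (fun psi : PhiP Phi Y => sval (sval psi)) (lift_sup (t y)).
by rewrite sup_lift => /esym.
Qed.

Definition to_split (y : Y) : split_space lift_idem :=
  exist _ _ (to_split_subproof y).

Definition of_split_presheaf (psi : split_space lift_idem) : PhiP Phi Y :=
  Phi_presheaf (svalP psi).1.

Definition of_split (psi : split_space lift_idem) : Y :=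
  Sup (of_split_presheaf psi).

Lemma to_splitK : cancel to_split of_split.
Proof.
move=> y; rewrite -[RHS]sup_lift; congr Sup; exact: PhiP_eq.
Qed.

Lemma of_splitK : cancel of_split to_split.
Proof.
move=> psi; apply: split_eq => x.
rewrite /split_ev /= lift_sup /=; have [_ ->] := svalP psi; done.
Qed.

Lemma to_split_map : is_map to_split.
Proof.
by have [tM _ _ _] := tP; apply/split_map; exact: (PhiP_map t).1 tM.
Qed.

Lemma of_split_map : is_map of_split.
Proof.
have [SupM _ _ _] := SupP.
apply: (is_map_comp SupM); apply/PhiP_map; exact: split_ev_module.
Qed.

End DistributiveSplits.

(** * The splitting functor and the equivalence *)

Lemma mod_hom_eq X Y (r s : mod_hom Phi X Y) : sval r = sval s -> r = s.
Proof. by case: r s => [r rP] [s sP] /= rs; exact: eq_exist. Qed.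

Lemma cancel_cocontinuous X Z (f : X -> Z) (g : Z -> X) :
  is_map f -> is_map g -> cancel f g -> cancel g f -> cocontinuous Phi f.
Proof.
move=> fM gM fK gK; apply: (@left_adjoint_cocontinuous _ _ _ _ _ g).
by split=> // x; rewrite /= ?fK ?gK; exact: conv_uprinc.
Qed.

Definition cancel_hom (X Z : dist_space Phi) (f : X -> Z) (g : Z -> X)
    (fM : is_map f) (gM : is_map g) (fK : cancel f g) (gK : cancel g f) :
    dist_hom X Z :=
  exist _ f (conj fM (cancel_cocontinuous fM gM fK gK)).

Definition split_ob (X : kar (Mod Phi)) : dist_space Phi :=
  DistSpace (split_distributive (svalP (kar_idem X))
                                (congr1 sval (kar_idemP X))).

Definition split_fun (X Y : op (kar (Mod Phi))) (f : hom X Y) :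
  dist_hom (split_ob X) (split_ob Y) :=
  let phiP := svalP (sval f) in
  let phie := congr1 sval (svalP f).2 in
  exist _ (split_hom phiP phie)
    (conj (split_hom_map phiP phie)
          (split_hom_cocontinuous phiP phie)).

Lemma split_fun_id (X : op (kar (Mod Phi))) :
  split_fun (idc X) = dist_id (split_ob X).
Proof.
apply: eq_exist; apply/funext => psi; apply: split_eq => x.
by have [_ /(congr1 (fun r => r x tt))] := svalP psi.
Qed.

Lemma split_fun_comp (X Y Z : op (kar (Mod Phi))) (g : hom Y Z) (f : hom X Y) :
  split_fun (ccomp g f) = dist_comp (split_fun g) (split_fun f).
Proof.
apply: eq_exist; apply/funext => psi; apply: split_eq => x.
by rewrite /split_ev /= kleisliA.
Qed.

Definition split_functor : functor (op (kar (Mod Phi))) (DSup Phi) :=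
  @Functor (op (kar (Mod Phi))) (DSup Phi) split_ob split_fun
    split_fun_id split_fun_comp.

Theorem kar_equivalent : equivalent (op (kar (Mod Phi))) (DSup Phi).
Proof.
apply: (full_faithful_equivalent (F := split_functor)).
- move=> X Y [[phi phiP] [ephi phie]] [[chi chiP] [echi chie]] FE.
  apply: eq_exist; apply: eq_exist.
  apply: (split_hom_inj (svalP (kar_idem X)) (congr1 sval (kar_idemP X))).
  + exact (congr1 sval ephi).
  + exact (congr1 sval echi).
  + apply/funext => x; apply/funext => psi.
    exact (congr1 (fun h => sval (sval h psi) x tt) FE).
- move=> X Y [h [hM hC]].
  have [phi [phiP phie ephi hE]] :=
    split_hom_surj (svalP (kar_idem X)) (congr1 sval (kar_idemP X))
      hM hC.
  unshelve eexists.
    exists (exist _ phi phiP); by split; apply: mod_hom_eq.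
  apply: eq_exist; apply/funext => psi; apply: split_eq => x.
  by rewrite /split_ev hE.
- move=> Y; have [Y0 [Sup SupP] /(_ _ SupP) [t tP]] := dist_distributive Y.
  pose e : mod_hom Phi Y Y := exist _ _ (lift_idem_class tP).
  have ee : mod_comp e e = e by apply: mod_hom_eq; exact: lift_idemK Y0 SupP tP.
  pose S := split_ob (KarOb (C := Mod Phi) ee).
  have toM := to_split_map Y0 SupP tP; have ofM := of_split_map SupP (t := t).
  have toK := to_splitK Y0 SupP tP; have ofK := of_splitK Y0 SupP tP.
  exists (KarOb (C := Mod Phi) ee), (@cancel_hom S Y _ _ ofM toM ofK toK).
  exists (@cancel_hom Y S _ _ toM ofM toK ofK).
  by split; apply: eq_exist; apply/funext.
Qed.
End Presheaves.

(** * Convergence in the Sierpinski space and in [0,∞] *)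

Lemma top_residual_limits : residual_limits top_theory.
Proof.
move=> u x w; rewrite /= /top_le /top_lim.
(* For two truth values, ξ(u) holds exactly when {true} belongs to u. *)
have -> : top_inf [set top_sup A | A in umem u] = `[< u [set true] >].
  rewrite /top_inf; apply: asbool_equiv_eq; split=> [H|u1].
    apply: contrapT => nu1; apply: H.
    have [//|uF] := in_ultra_setVsetC [set true] (umemP u).
    exists (~` [set true]) => //; rewrite /top_sup.
    by apply/asboolP => /(_ erefl).
  move=> [A uA]; rewrite /top_sup => /asboolP; apply.
  by have [_ [-> //]] := umem_ex (umemI u1 uA).
case: w => //=; split=> [/asboolP H|/implyP H].
  by apply/implyP => /asboolP /H ->.
by apply/asboolP => u1; apply: H; exact/asboolP.
Qed.

Section Approach.
Variable R : realType.
Local Open Scope ereal_scope.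

Lemma app_xi_ge0 (u : ultrafilter (nnereal R)) : 0 <= app_xi u.
Proof.
apply: (@le_trans _ _ (ereal_inf [set sval x | x in [set: nnereal R]])).
  exact: nnereal_inf_ge0.
by apply: ereal_sup_ubound; exists setT => //; exact: umemT.
Qed.

Lemma app_uxiE (u : ultrafilter (nnereal R)) :
  sval (uxi (T := app_theory R) u) = app_xi u.
Proof.
apply/eqP; rewrite eq_le; apply/andP; split.
  (* The 0 inserted in [app_inf] does not raise the supremum, since ξ(u) is nonnegative. *)
  apply: ge_ereal_sup => _ [->|[_ [A uA <-] <-]]; first exact: app_xi_ge0.
  by apply: ereal_sup_ubound; exists A.
apply: ge_ereal_sup => _ [A uA <-]; apply: ereal_sup_ubound; right.
by exists (app_sup A) => //; exists A.
Qed.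

Lemma app_residual_limits : residual_limits (app_theory R).
Proof.
move=> u x w; rewrite /= /app_le /=; have /= -> := app_uxiE u.
have := app_xi_ge0 u; move: (app_xi u) => k k0.
rewrite ge_max nnereal_ge0 andbT.
case: k k0 => [k| |] //= k0; first by rewrite EFinN leeBlDr.
rewrite addey; last by rewrite gt_eqF// (lt_le_trans _ (nnereal_ge0 w)).
rewrite leey; split=> // _.
(* When ξ(u) is infinite both sides hold; for infinite [x] the difference is -oo. *)
by case: x => -[x| |] x0 //=; rewrite leNye.
Qed.

End Approach.

Theorem theorem9p8 :
  (forall Phi : module_class top_theory,
     equivalent (op (kar (Mod Phi))) (DSup Phi)) /\
  (forall (R : realType) (Phi : module_class (app_theory R)),
     equivalent (op (kar (Mod Phi))) (DSup Phi)).
Proof.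
split=> [Phi|R Phi]; apply: kar_equivalent.
  exact: top_residual_limits.
exact: app_residual_limits.
Qed.
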